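(* With the parameters $(\mu_j/\mu_k)^2=a^{k-j}\frac{(N-k)!}{(N-j)!}$ and $\delta_k^{(\lambda)}=\left(\frac a2\right)^\lambda\frac{(\lambda+k-1)!}{(k-1)!}$, the diagonal matrices $\mathcal D_n^{(\lambda)}$ are given, for all $n\in\mathbb N_0$ and $1\le j\le N$, by $$(\mathcal D_n^{(\lambda)})_{jj}=(-1)^je^an!\,a^n\left(\frac a2\right)^\lambda\frac{(\lambda+N-j)!}{(j-1)!}\frac{(-N-\lambda-n)_j}{(\lambda+n+1)_{N-j+1}}.$$ Moreover the following recursion holds: $$\mathcal D_n^{(\lambda)}=n!\,2^n\,\mathcal D_0^{(\lambda+n)}\bigl(\Lambda_n^{(\lambda)}\bigr)^{-1},\qquad\Lambda_n^{(\lambda)}=\prod_{m=1}^n\bigl((N+\lambda+m)I-J\bigr).$$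
   Context: $N\ge1$, $a>0$, $\lambda\in\mathbb N_0=\{0,1,2,\dots\}$; $(z)_j=z(z+1)\cdots(z+j-1)$ is the Pochhammer symbol. $\mu_1,\dots,\mu_N>0$. $A$ is the $N\times N$ matrix whose only nonzero entries are $A_{k+1,k}=\mu_{k+1}/\mu_k=\sqrt{(N-k)/a}$, $1\le k\le N-1$; $J=\mathrm{diag}(1,\dots,N)$; $T^{(\lambda)}=\mathrm{diag}(\delta_1^{(\lambda)},\dots,\delta_N^{(\lambda)})$; $L_0$ is lower triangular with $(L_0)_{jk}=\frac{\mu_j}{\mu_k}\frac{(-a)^{j-k}}{(j-k)!}$ for $j\ge k$. The weight is $W^{(\lambda)}(x)=\frac{a^x}{x!}(I+A)^{x+\lambda}T^{(\lambda)}(I+A^* )^{x+\lambda}$, $x\in\mathbb N_0$; $(P_n^{(\lambda)})_n$ are its monic matrix orthogonal polynomials for $\langle P,Q\rangle^{(\lambda)}=\sum_{x=0}^\infty P(x)W^{(\lambda)}(x)Q(x)^*$, and $\mathcal H_n^{(\lambda)}=\langle P_n^{(\lambda)},P_n^{(\lambda)}\rangle^{(\lambda)}$. $\mathcal D_n^{(\lambda)}$ is the positive definite diagonal matrix in the decomposition $\mathcal H_n^{(\lambda)}=L_0^{-1}(I+A)^{n+\lambda}\mathcal D_n^{(\lambda)}(I+A^* )^{n+\lambda}(L_0^* )^{-1}$. *)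

(* Defs.v *)
From HB Require Import structures.
From mathcomp Require Import all_boot all_order all_algebra.
From mathcomp Require Import sesquilinear spectral complex.
From mathcomp Require Import all_classical all_reals all_analysis.

Set Implicit Arguments.
Unset Strict Implicit.
Unset Printing Implicit Defensive.

Import Order.TTheory GRing.Theory Num.Theory.
Import numFieldNormedType.Exports.

Local Open Scope complex_scope.
Local Open Scope sesquilinear_scope.
Local Open Scope classical_set_scope.
Local Open Scope ring_scope.

(* Rows and columns are indexed by 'I_N, i.e. from 0: the index i : 'I_N stands
   for the index i.+1 of the mathematical text. *)

Definition poch (K : pzRingType) (z : K) (j : nat) : K :=
  \prod_(i < j) (z + i%:R).

Definition cseries (R : realType) (u : nat -> R[i]) : R[i] :=
  limn (series (u : nat -> R[i]^o)).

Definition posdefmx (R : realType) (N : nat) (M : 'M[R[i]]_N) : Prop :=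
  M ^t* = M /\
  forall v : 'rV[R[i]]_N, v != 0 -> 0 < (v *m M *m v ^t*) ord0 ord0.

(* Matrix polynomials are matrices of polynomials: the coefficient of x^k in P
   is the matrix of the coefficients (P i j)`_k. *)

Definition mxeval (R : realType) (N : nat) (P : 'M[{poly R[i]}]_N) (x : R[i]) :
  'M[R[i]]_N := \matrix_(i, j) (P i j).[x].

Definition monic_of_degree (R : realType) (N : nat) (n : nat)
    (P : 'M[{poly R[i]}]_N) : Prop :=
  (forall i j, (size (P i j) <= n.+1)%N) /\
  \matrix_(i, j) (P i j)`_n = 1%:M :> 'M[R[i]]_N.

(* For the weights considered here the defining series converges for all matrix
   polynomials P and Q, so that the limit is never a default value. *)
Definition mxip (R : realType) (N : nat) (W : nat -> 'M[R[i]]_N)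
    (P Q : 'M[{poly R[i]}]_N) : 'M[R[i]]_N :=
  \matrix_(i, j) cseries (fun x : nat =>
    (mxeval P x%:R *m W x *m (mxeval Q x%:R) ^t*) i j).

Definition monic_orthogonal (R : realType) (N : nat) (W : nat -> 'M[R[i]]_N)
    (P : nat -> 'M[{poly R[i]}]_N) : Prop :=
  (forall n, monic_of_degree n (P n)) /\
  (forall m n, m != n -> mxip W (P m) (P n) = 0).

Definition Amx (R : realType) (N : nat) (mu : 'I_N -> R) : 'M[R[i]]_N :=
  \matrix_(j, k) (if j == k.+1 :> nat then (mu j / mu k)%:C else 0).

Definition Jmx (R : realType) (N : nat) : 'M[R[i]]_N :=
  diag_mx (\row_(j < N) (j.+1)%:R).

Definition Tmx (R : realType) (N : nat) (delta : 'I_N -> R) : 'M[R[i]]_N :=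
  diag_mx (\row_(k < N) (delta k)%:C).

Definition L0mx (R : realType) (N : nat) (a : R) (mu : 'I_N -> R) :
  'M[R[i]]_N :=
  \matrix_(j, k) (if (k <= j)%N
    then (mu j / mu k * ((- a) ^+ (j - k) / ((j - k)`!)%:R))%:C else 0).

Definition weight (R : realType) (N : nat) (a : R) (mu : 'I_N -> R)
    (delta : nat -> 'I_N -> R) (lam : nat) (x : nat) : 'M[R[i]]_N :=
  (a ^+ x / (x`!)%:R)%:C *:
    ((1%:M + Amx mu) ^+ (x + lam) *m Tmx (delta lam)
       *m (1%:M + (Amx mu) ^t*) ^+ (x + lam)).

Definition Hmx (R : realType) (N : nat) (a : R) (mu : 'I_N -> R)
    (delta : nat -> 'I_N -> R) (P : nat -> nat -> 'M[{poly R[i]}]_N)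
    (lam n : nat) : 'M[R[i]]_N :=
  mxip (weight a mu delta lam) (P lam n) (P lam n).

Definition is_Dmx (R : realType) (N : nat) (a : R) (mu : 'I_N -> R)
    (delta : nat -> 'I_N -> R) (P : nat -> nat -> 'M[{poly R[i]}]_N)
    (lam n : nat) (D : 'M[R[i]]_N) : Prop :=
  [/\ is_diag_mx D, posdefmx D &
    Hmx a mu delta P lam n =
      invmx (L0mx a mu) *m (1%:M + Amx mu) ^+ (n + lam) *m D
        *m (1%:M + (Amx mu) ^t*) ^+ (n + lam) *m invmx ((L0mx a mu) ^t*)].

Definition Lambdamx (R : realType) (N : nat) (lam n : nat) : 'M[R[i]]_N :=
  \prod_(1 <= m < n.+1) (((N + lam + m)%:R)%:M - Jmx R N).

(* Main.v *)
Require Import Defs.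
From HB Require Import structures.
From mathcomp Require Import all_boot all_order all_algebra.
From mathcomp Require Import sesquilinear spectral complex.
From mathcomp Require Import all_classical all_reals all_analysis.
From mathcomp Require Import ring zify.

Set Implicit Arguments.
Unset Strict Implicit.
Unset Printing Implicit Defensive.

Import Order.TTheory GRing.Theory Num.Theory.
Import numFieldNormedType.Exports.

Local Open Scope complex_scope.
Local Open Scope sesquilinear_scope.
Local Open Scope classical_set_scope.
Local Open Scope ring_scope.

(** Write B for the adjoint of A, and split the weight into the Poisson factor
    a^x / x! and the matrix C_l(x) = (1 + A)^(x+l) T_l (1 + B)^(x+l), which is
    polynomial in x because A is nilpotent. All inner products are then values
    of a single linear functional on polynomial sequences, the Poisson sum
    psum u = sum_x a^x / x! u(x); it is determined by psum 1 = e^a and by the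
    shift rule psum (x u(x-1)) = a psum u.

    Recursion in n. With X = a A J and h = N + 1 - 2 J one has
    B J - J B = B, B X - X B = h and h B - B h = 2 B. These relations let J and X
    be moved through powers of 1 + B, and together with the special form of
    delta they give the Pearson equations
      C_{l+1}(x) = C_l(x) Phi(x)  and  (x/a) C_{l+1}(x-1) = C_l(x) Theta(x),
    where Phi and Theta are quadratic in x with the same coefficient of x^2
    (pearson_fwd, pearson_back). Let P = P_{m+1}^(l) and Q = P_m^(l+1). The inner
    product for l+1 of P(x+1) - P(x) with Q is (m+1) H_m^(l+1), since the
    difference has degree m and leading coefficient m+1. By the shift rule and
    the Pearson equations it is also the inner product for l of P with a
    polynomial of degree m+1, that is H_{m+1}^(l) K for an explicit upper
    triangular matrix K (ladder, ladder_mx_upper). Both sides of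
    (m+1) H_m^(l+1) = H_{m+1}^(l) K carry the same lower unitriangular factor
    in their decompositions, so comparing diagonal entries yields
      D_{m+1}^(l) (N + l - j) / 2 = (m+1) D_m^(l+1)      (D_step)
    in row j, counted from 0.

    Initial value. The entries of L_0 (1 + A)^x are Charlier polynomials, up to
    the ratios of the mu, and their norms turn the diagonal of D_0 into a
    binomial convolution (D_zero, bin_convolution, D_zeroE).

    Induction on n gives a closed form in factorials (D_closedE), of which both
    assertions of the theorem are rewritings. *)

(** * Poisson sums of polynomial sequences *)

Section poisson.
Variables (R : realType) (a : R).
Local Notation C := R[i].

Definition has_psum (u : nat -> C) (l : C) : Prop :=
  series (fun x => (a ^+ x / (x`!)%:R)%:C * u x : C^o) @ \oo --> (l : C^o).

(** Up to the factor e^a, this is the expectation under the Poisson law of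
    parameter a. *)
Definition psum (u : nat -> C) : C :=
  cseries (fun x => (a ^+ x / (x`!)%:R)%:C * u x).

Lemma has_psum_eq u l : has_psum u l -> psum u = l.
Proof.
by move=> h; exact: (@cvg_lim (C^o) (@norm_hausdorff C (C^o)) _ \oo _ _ _ h).
Qed.

Lemma has_psumD u v l m : has_psum u l -> has_psum v m ->
  has_psum (fun x => u x + v x) (l + m).
Proof.
move=> hu hv; rewrite /has_psum.
have -> : (series (fun x => (a ^+ x / (x`!)%:R)%:C * (u x + v x) : C^o)) =
   (series (fun x => (a ^+ x / (x`!)%:R)%:C * u x : C^o)) +
   (series (fun x => (a ^+ x / (x`!)%:R)%:C * v x : C^o)).
  apply/funext => n; rewrite /series /= fctE /= -big_split /=.
  by apply: eq_bigr => i _; rewrite mulrDr.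
exact: (@cvgD C (C^o) nat \oo _ _ _ _ _ hu hv).
Qed.

Lemma has_psumZ c u l : has_psum u l -> has_psum (fun x => c * u x) (c * l).
Proof.
move=> hu; rewrite /has_psum.
have -> : (series (fun x => (a ^+ x / (x`!)%:R)%:C * (c * u x) : C^o)) =
   (fun n => c * (series (fun x => (a ^+ x / (x`!)%:R)%:C * u x : C^o)) n).
  apply/funext => n; rewrite /series /= mulr_sumr.
  by apply: eq_bigr => i _; rewrite mulrCA.
exact: (@cvgMl_tmp C _ _ _ _ c).
Qed.

(** Since (y+1) a^(y+1) / (y+1)! = a a^y / y!, multiplication by x is, up to the
    factor a, adjoint to the shift. *)
Lemma has_psum_shift u l : has_psum u l ->
  has_psum (fun x => x%:R * u x.-1) (a%:C * l).
Proof.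
move=> hu; rewrite /has_psum -cvg_shiftS.
have -> : ([sequence (series (fun x => (a ^+ x / (x`!)%:R)%:C * (x%:R * u x.-1) : C^o)) n.+1]_n) =
   (fun n => a%:C * (series (fun x => (a ^+ x / (x`!)%:R)%:C * u x : C^o)) n).
  apply/funext => n; rewrite /series /= big_nat_recl //= mul0r mulr0 add0r mulr_sumr.
  apply: eq_bigr => i _; rewrite !mulrA; congr (_ * _).
  rewrite -(rmorph_nat (real_complex R) i.+1) -!rmorphM /=; congr (_%:C).
  have h1 : (i`!%:R : R) != 0 by rewrite pnatr_eq0 -lt0n fact_gt0.
  have h2 : (i.+1%:R : R) != 0 by rewrite pnatr_eq0.
  by rewrite factS natrM exprS; field; rewrite h1 /= -natr1 addrC in h2 *.
exact: (@cvgMl_tmp C _ _ _ _ (a%:C)).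
Qed.

Lemma real_complex_cvg (f : nat -> R) (l : R) :
  f @ \oo --> l -> ((f n)%:C : C^o) @[n --> \oo] --> (l%:C : C^o).
Proof.
move=> /cvgrPdist_lt h; apply/cvgrPdist_lt => e e0.
have [eR eI] : 0 < complex.Re e /\ complex.Im e = 0.
  by case: e e0 => x y; rewrite ltcE /= => /andP[/eqP -> ?].
apply: filterS (h _ eR) => n hn.
rewrite -rmorphB /= normc_def /= expr0n /= addr0 sqrtr_sqr.
by case: e eR eI {e0} hn => x y /= _ -> hn; rewrite ltcR.
Qed.

Lemma has_psum1 : has_psum (fun _ => 1) (expR a)%:C.
Proof.
have h : series (exp_coeff a) @ \oo --> expR a by exact: is_cvg_series_exp_coeff.
have := real_complex_cvg h; rewrite /has_psum.
suff -> : (series (fun x => (a ^+ x / (x`!)%:R)%:C * 1 : C^o)) =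
  (fun n => (series (exp_coeff a) n)%:C) by [].
apply/funext => n; rewrite /series /= rmorph_sum /=.
by apply: eq_bigr => i _; rewrite mulr1.
Qed.

(** Only the values at natural numbers are constrained, so that matrix powers
    with exponent x can be treated as polynomial in x. *)
Definition polyfun (u : nat -> C) := exists p : {poly C}, forall x, u x = p.[x%:R].

(** A polynomial is a constant plus X q, and X q is x times the shift of a
    polynomial of smaller degree; the shift rule thus reduces convergence to
    that of the exponential series. *)
Lemma polyfun_has_psum u : polyfun u -> exists l, has_psum u l.
Proof.
move=> [p hp]; have -> : u = fun x => p.[x%:R] by apply/funext.
move: {hp} (leqnn (size p)); move: {2}(size p) => n.
elim: n p => [|n IH] p.
  rewrite size_poly_leq0 => /eqP ->; exists (0 * (expR a)%:C).
  have := has_psumZ (c := 0) has_psum1; congr has_psum.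
  by apply/funext => x; rewrite horner0 mul0r.
elim/poly_ind: p => [|q c _]; first by move=> _; apply: IH; rewrite size_poly0.
move=> hs.
have hq : (size q <= n)%N.
  have [->|q0] := eqVneq q 0; first by rewrite size_poly0.
  by move: hs; rewrite size_MXaddC (negbTE q0).
have [|l hl] := IH (q \Po ('X + 1%:P)).
  by rewrite size_comp_poly2 // -[1%:P]opprK -polyCN size_XsubC.
exists (a%:C * l + c * (expR a)%:C).
have := has_psumD (has_psum_shift hl) (has_psumZ (c := c) has_psum1).
congr has_psum; apply/funext => x.
rewrite hornerMXaddC mulr1 mulrC horner_comp hornerD hornerX hornerC.
by case: x => [|x]; [rewrite !mulr0 ?mul0r | rewrite natr1].
Qed.

Lemma polyfun_psumP u : polyfun u -> has_psum u (psum u).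
Proof. by move=> /polyfun_has_psum[l hl]; rewrite (has_psum_eq hl). Qed.

Lemma polyfun_cst c : polyfun (fun=> c).
Proof. by exists c%:P => x; rewrite hornerC. Qed.

Lemma polyfunD u v : polyfun u -> polyfun v -> polyfun (fun x => u x + v x).
Proof. by move=> [p hp] [q hq]; exists (p + q) => x; rewrite hornerD hp hq. Qed.

Lemma polyfunM u v : polyfun u -> polyfun v -> polyfun (fun x => u x * v x).
Proof. by move=> [p hp] [q hq]; exists (p * q) => x; rewrite hornerM hp hq. Qed.

Lemma polyfunS u : polyfun u -> polyfun (fun x => u x.+1).
Proof.
move=> [p hp]; exists (p \Po ('X + 1%:P)) => x.
by rewrite hp horner_comp hornerD hornerX hornerC natr1.
Qed.

Lemma polyfun_shift u : polyfun u -> polyfun (fun x => x%:R * u x.-1).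
Proof.
move=> [p hp]; exists ('X * (p \Po ('X - 1%:P))) => -[|x].
  by rewrite mul0r hornerM hornerX mul0r.
by rewrite hp hornerM horner_comp hornerD hornerN hornerX hornerC -natr1 addrK.
Qed.

Lemma polyfun_conj u : polyfun u -> polyfun (fun x => (u x)^*).
Proof.
move=> [p hp]; exists (map_poly Num.conj p) => x.
by rewrite hp -[LHS]horner_map /= conjC_nat.
Qed.

Lemma polyfun_sum (I : Type) (r : seq I) (F : I -> nat -> C) :
  (forall i, polyfun (F i)) -> polyfun (fun x => \sum_(i <- r) F i x).
Proof.
move=> h; elim: r => [|i r IH].
  by exists 0 => x; rewrite big_nil horner0.
by have [p hp] := polyfunD (h i) IH; exists p => x; rewrite big_cons hp.
Qed.

Lemma polyfun_bin m : polyfun (fun x => 'C(x, m)%:R).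
Proof.
elim: m => [|m [p hp]]; first by exists 1 => x; rewrite bin0 hornerC.
exists ((m.+1%:R)^-1 *: (('X - (m%:R)%:P) * p)) => x.
rewrite hornerZ hornerM !hornerE /= -hp.
apply: (mulfI (x := m.+1%:R)); first by rewrite pnatr_eq0.
rewrite -[X in _ = _ * X]mulrA mulVKf ?pnatr_eq0 // -natrM mul_bin_left natrM.
have [h|h] := leqP m x; first by rewrite natrB.
by rewrite bin_small // !mulr0.
Qed.

Lemma psumD u v : polyfun u -> polyfun v ->
  psum (fun x => u x + v x) = psum u + psum v.
Proof. by move=> hu hv; apply/has_psum_eq/has_psumD; exact: polyfun_psumP. Qed.

Lemma psumZ c u : polyfun u -> psum (fun x => c * u x) = c * psum u.
Proof. by move=> hu; apply/has_psum_eq/has_psumZ; exact: polyfun_psumP. Qed.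

Lemma psum_shift u : polyfun u -> psum (fun x => x%:R * u x.-1) = a%:C * psum u.
Proof. by move=> hu; apply/has_psum_eq/has_psum_shift; exact: polyfun_psumP. Qed.

Lemma psum1 : psum (fun=> 1) = (expR a)%:C.
Proof. exact/has_psum_eq/has_psum1. Qed.

Lemma psum_sum (I : Type) (r : seq I) (F : I -> nat -> C) :
  (forall i, polyfun (F i)) ->
  psum (fun x => \sum_(i <- r) F i x) = \sum_(i <- r) psum (F i).
Proof.
move=> h; elim: r => [|i r IH].
  rewrite big_nil -[RHS](mul0r (psum (fun => 1))) -psumZ; last exact: polyfun_cst.
  by congr psum; apply/funext => x; rewrite big_nil mul0r.
rewrite big_cons -IH -psumD //; last exact: polyfun_sum.
by congr psum; apply/funext => x; rewrite big_cons.
Qed.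

End poisson.

(** * Matrix inner products and orthogonality *)

Section mxpoisson.
Variables (R : realType) (a : R) (N : nat).
Local Notation C := R[i].
Implicit Types (F G : nat -> 'M[C]_N) (K : 'M[C]_N) (S : 'M[{poly C}]_N).

Definition mpolyfun F := forall i j, polyfun (fun x => F x i j).
Definition mxpsum F : 'M[C]_N := \matrix_(i, j) psum a (fun x => F x i j).

Lemma mpolyfun_cst K : mpolyfun (fun=> K).
Proof. by move=> i j; exact: polyfun_cst. Qed.

Lemma mpolyfunM F G : mpolyfun F -> mpolyfun G -> mpolyfun (fun x => F x *m G x).
Proof.
move=> hF hG i j.
have [p hp] := polyfun_sum (index_enum 'I_N) (fun k => polyfunM (hF i k) (hG k j)).
by exists p => x; rewrite mxE hp.
Qed.

Lemma mpolyfunS F : mpolyfun F -> mpolyfun (fun x => F x.+1).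
Proof. by move=> h i j; exact: (polyfunS (h i j)). Qed.

Lemma mpolyfun_adj F : mpolyfun F -> mpolyfun (fun x => (F x) ^t*).
Proof.
move=> h i j; have [p hp] := polyfun_conj (h j i).
by exists p => x; rewrite !mxE hp.
Qed.

Lemma mpolyfun_mxeval S : mpolyfun (fun x => mxeval S x%:R).
Proof. by move=> i j; exists (S i j) => x; rewrite mxE. Qed.

Lemma mxpsumD F G : mpolyfun F -> mpolyfun G ->
  mxpsum (fun x => F x + G x) = mxpsum F + mxpsum G.
Proof.
move=> hF hG; apply/matrixP => i j; rewrite !mxE -psumD //.
by congr psum; apply/funext => x; rewrite mxE.
Qed.

Lemma mxpsumMl K F : mpolyfun F -> mxpsum (fun x => K *m F x) = K *m mxpsum F.
Proof.
move=> hF; apply/matrixP => i j; rewrite !mxE.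
under eq_bigr => k _ do rewrite mxE -psumZ //.
rewrite -psum_sum; first by congr psum; apply/funext => x; rewrite mxE.
by move=> k; apply: polyfunM => //; exact: polyfun_cst.
Qed.

Lemma mxpsumMr K F : mpolyfun F -> mxpsum (fun x => F x *m K) = mxpsum F *m K.
Proof.
move=> hF; apply/matrixP => i j; rewrite !mxE.
under eq_bigr => k _ do rewrite mxE mulrC -psumZ //.
rewrite -psum_sum.
  congr psum; apply/funext => x; rewrite mxE.
  by apply: eq_bigr => k _; rewrite mulrC.
by move=> k; apply: polyfunM => //; exact: polyfun_cst.
Qed.

Lemma mxpsum_shift F : mpolyfun F ->
  mxpsum (fun x => x%:R *: F x.-1) = a%:C *: mxpsum F.
Proof.
move=> hF; apply/matrixP => i j; rewrite !mxE -psum_shift //.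
by congr psum; apply/funext => x; rewrite mxE.
Qed.

Definition coefmx n S : 'M[C]_N := \matrix_(i, j) (S i j)`_n.
Definition polymx K : 'M[{poly C}]_N := map_mx polyC K.
Definition sizemx_le S n := forall i j, (size (S i j) <= n)%N.

Lemma coefmxB n S1 S2 : coefmx n (S1 - S2) = coefmx n S1 - coefmx n S2.
Proof. by apply/matrixP => i j; rewrite !mxE coefB. Qed.

Lemma coefmxD n S1 S2 : coefmx n (S1 + S2) = coefmx n S1 + coefmx n S2.
Proof. by apply/matrixP => i j; rewrite !mxE coefD. Qed.

Lemma coefmxMl n K S : coefmx n (polymx K *m S) = K *m coefmx n S.
Proof.
apply/matrixP => i j; rewrite !mxE coef_sum.
by apply: eq_bigr => k _; rewrite !mxE coefCM.
Qed.

Lemma coefmxMr n K S : coefmx n (S *m polymx K) = coefmx n S *m K.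
Proof.
apply/matrixP => i j; rewrite !mxE coef_sum.
by apply: eq_bigr => k _; rewrite !mxE coefMC.
Qed.

Lemma sizemx_leP S n : sizemx_le S n <-> forall k, (n <= k)%N -> coefmx k S = 0.
Proof.
split=> [h k nk|h i j].
  by apply/matrixP => i j; rewrite !mxE nth_default // (leq_trans (h i j)).
by apply/leq_sizeP => k nk; move/matrixP: (h k nk) => /(_ i j); rewrite !mxE.
Qed.

Lemma mxevalD S1 S2 x : mxeval (S1 + S2) x = mxeval S1 x + mxeval S2 x.
Proof. by apply/matrixP => i j; rewrite !mxE hornerD. Qed.

Lemma mxevalM S1 S2 x : mxeval (S1 *m S2) x = mxeval S1 x *m mxeval S2 x.
Proof.
apply/matrixP => i j; rewrite !mxE horner_sum.
by apply: eq_bigr => k _; rewrite !mxE hornerM.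
Qed.

Lemma mxeval_polymx K x : mxeval (polymx K) x = K.
Proof. by apply/matrixP => i j; rewrite !mxE hornerC. Qed.

Lemma sizemx_sub_lead n P S : monic_of_degree n P -> sizemx_le S n.+1 ->
  sizemx_le (S - polymx (coefmx n S) *m P) n.
Proof.
move=> [sP mP] hS; apply/sizemx_leP => k.
rewrite leq_eqVlt coefmxB coefmxMl => /predU1P[<-|nk].
  by rewrite [coefmx n P]mP mulmx1 subrr.
have /sizemx_leP -> // := hS.
have /sizemx_leP -> // : sizemx_le P n.+1 by [].
by rewrite mulmx0 subrr.
Qed.

(** Subtracting its leading coefficient times P n lowers the degree of S, so
    that P 0, ..., P n.-1 generate all S of degree below n. An abstract f serves
    both arguments of the inner product: in the second one, constant matrices
    come out on the right as adjoints. *)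
Lemma vanish_below_degree (V : zmodType) (P : nat -> 'M[{poly C}]_N)
    (f : 'M[{poly C}]_N -> V) :
  (forall n, monic_of_degree n (P n)) ->
  (forall S1 S2, f (S1 - S2) = f S1 - f S2) ->
  (forall K S, f S = 0 -> f (polymx K *m S) = 0) ->
  forall n S, (forall k, (k < n)%N -> f (P k) = 0) -> sizemx_le S n -> f S = 0.
Proof.
move=> Pm fB fK; elim=> [|n IH] S fP hS.
  have -> : S = S - S by rewrite subrr; apply/matrixP => i j; rewrite mxE;
    apply/eqP; rewrite -size_poly_leq0.
  by rewrite fB subrr.
have -> : S = (S - polymx (coefmx n S) *m P n) - (0 - polymx (coefmx n S) *m P n).
  by rewrite sub0r opprK subrK.
have f0 : f 0 = 0 by rewrite -[0](subrr 0) fB subrr.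
rewrite fB [f (0 - _)]fB f0 (fK _ _ (fP n _)) // !subr0.
apply: IH => [k kn|]; first by apply: fP; apply: ltnW.
exact: sizemx_sub_lead.
Qed.

End mxpoisson.

Section poisson_weight.
Variables (R : realType) (a : R) (N : nat) (core W : nat -> 'M[R[i]]_N).
Local Notation C := R[i].
Hypothesis core_poly : mpolyfun core.
Hypothesis W_core : forall x, W x = (a ^+ x / (x`!)%:R)%:C *: core x.

Lemma mxip_mxpsum P Q :
  mxip W P Q = mxpsum a (fun x => mxeval P x%:R *m core x *m (mxeval Q x%:R) ^t*).
Proof.
apply/matrixP => i j; rewrite !mxE /psum; congr cseries; apply/funext => x.
by rewrite W_core -scalemxAr -scalemxAl mxE.
Qed.

Lemma mpolyfun_ip P Q :
  mpolyfun (fun x => mxeval P x%:R *m core x *m (mxeval Q x%:R) ^t*).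
Proof.
apply: mpolyfunM; first by apply: mpolyfunM => //; exact: mpolyfun_mxeval.
by apply: mpolyfun_adj; exact: mpolyfun_mxeval.
Qed.

Lemma mxipMl K P Q : mxip W (polymx K *m P) Q = K *m mxip W P Q.
Proof.
rewrite !mxip_mxpsum -mxpsumMl; last exact: mpolyfun_ip.
by congr mxpsum; apply/funext => x; rewrite mxevalM mxeval_polymx !mulmxA.
Qed.

Lemma mxipMr K P Q : mxip W P (polymx K *m Q) = mxip W P Q *m K ^t*.
Proof.
rewrite !mxip_mxpsum -mxpsumMr; last exact: mpolyfun_ip.
congr mxpsum; apply/funext => x.
by rewrite mxevalM mxeval_polymx trmx_mul map_mxM !mulmxA.
Qed.

Lemma mxipDl P1 P2 Q : mxip W (P1 + P2) Q = mxip W P1 Q + mxip W P2 Q.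
Proof.
rewrite !mxip_mxpsum -mxpsumD; try exact: mpolyfun_ip.
by congr mxpsum; apply/funext => x; rewrite mxevalD !mulmxDl.
Qed.

Lemma mxipDr P Q1 Q2 : mxip W P (Q1 + Q2) = mxip W P Q1 + mxip W P Q2.
Proof.
rewrite !mxip_mxpsum -mxpsumD; try exact: mpolyfun_ip.
by congr mxpsum; apply/funext => x; rewrite mxevalD linearD map_mxD mulmxDr.
Qed.

Lemma mxipBl P1 P2 Q : mxip W (P1 - P2) Q = mxip W P1 Q - mxip W P2 Q.
Proof. by apply/eqP; rewrite eq_sym subr_eq -mxipDl subrK. Qed.

Lemma mxipBr P Q1 Q2 : mxip W P (Q1 - Q2) = mxip W P Q1 - mxip W P Q2.
Proof. by apply/eqP; rewrite eq_sym subr_eq -mxipDr subrK. Qed.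

Variable P : nat -> 'M[{poly R[i]}]_N.
Hypothesis P_mop : monic_orthogonal W P.

(** What remains of S after subtracting its leading coefficient times P n has
    degree below n, hence is orthogonal to P n. *)
Lemma mxip_lead_l n S : sizemx_le S n.+1 ->
  mxip W S (P n) = coefmx n S *m mxip W (P n) (P n).
Proof.
move=> hS; apply/eqP; rewrite -mxipMl -subr_eq0 -mxipBl; apply/eqP.
apply: (vanish_below_degree (f := fun S => mxip W S (P n)) P_mop.1).
- by move=> S1 S2; exact: mxipBl.
- by move=> K S1 h; rewrite mxipMl h mulmx0.
- by move=> k kn; rewrite P_mop.2 // neq_ltn kn.
exact: sizemx_sub_lead (P_mop.1 n) hS.
Qed.

Lemma mxip_lead_r n S : sizemx_le S n.+1 ->
  mxip W (P n) S = mxip W (P n) (P n) *m (coefmx n S) ^t*.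
Proof.
move=> hS; apply/eqP; rewrite -mxipMr -subr_eq0 -mxipBr; apply/eqP.
apply: (vanish_below_degree (f := fun S => mxip W (P n) S) P_mop.1).
- by move=> S1 S2; exact: mxipBr.
- by move=> K S1 h; rewrite mxipMr h mul0mx.
- by move=> k kn; rewrite P_mop.2 // neq_ltn kn orbT.
exact: sizemx_sub_lead (P_mop.1 n) hS.
Qed.

End poisson_weight.

(** * Finite differences of matrix polynomials *)

Section finite_difference.
Variables (R : realType) (N : nat).
Local Notation C := R[i].

Lemma coef_shift (c : C) (p : {poly C}) n k : (size p <= n)%N ->
  (p \Po ('X + c%:P))`_k = \sum_(i < n) p`_i * (c ^+ (i - k) *+ 'C(i, k)).
Proof.
move=> hp; rewrite comp_polyE coef_sum.
rewrite (big_ord_widen n (fun i => (p`_i *: ('X + c%:P) ^+ i)`_k)) // big_mkcond /=.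
apply: eq_bigr => i _; case: ltnP => [_|hi]; last by rewrite nth_default ?mul0r.
rewrite coefZ; congr (_ * _).
rewrite addrC exprDn coef_sum; have [ki|ki] := ltnP k i.+1.
  rewrite (bigD1 (Ordinal ki)) //= big1 ?addr0.
    by rewrite coefMn -rmorphXn /= coefCM coefXn eqxx mulr1.
  move=> l lk; rewrite coefMn -rmorphXn /= coefCM coefXn.
  by rewrite -[k == l]/(Ordinal ki == l) eq_sym (negbTE lk) mulr0 mul0rn.
rewrite bin_small // mulr0n big1 // => l _.
by rewrite coefMn -rmorphXn /= coefCM coefXn gtn_eqF ?mulr0 ?mul0rn // (leq_trans (ltn_ord l)).
Qed.

Definition shiftmx (c : C) (S : 'M[{poly C}]_N) : 'M[{poly C}]_N :=
  \matrix_(i, j) (S i j \Po ('X + c%:P)).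

Lemma mxeval_shiftmx c S x : mxeval (shiftmx c S) x = mxeval S (x + c).
Proof. by apply/matrixP => i j; rewrite !mxE horner_comp !hornerE. Qed.

Lemma sizemx_shiftmx c S n : sizemx_le S n -> sizemx_le (shiftmx c S) n.
Proof.
by move=> h i j; rewrite mxE size_comp_poly2 // -[c%:P]opprK -polyCN size_XsubC.
Qed.

Lemma coefmx_shiftmx_lead c S n : sizemx_le S n.+1 ->
  coefmx n (shiftmx c S) = coefmx n S.
Proof.
move=> h; apply/matrixP => i j; rewrite !mxE (coef_shift _ _ (h i j)).
rewrite big_ord_recr /= subnn binn mulr1 big1 ?add0r // => l _.
by rewrite bin_small // mulr0n mulr0.
Qed.

Lemma sizemx_diff c S n : sizemx_le S n.+1 -> sizemx_le (shiftmx c S - S) n.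
Proof.
move=> h; apply/sizemx_leP => k; rewrite leq_eqVlt coefmxB => /predU1P[<-|nk].
  by rewrite coefmx_shiftmx_lead // subrr.
have /sizemx_leP -> // := sizemx_shiftmx c h.
by have /sizemx_leP -> // := h; rewrite subrr.
Qed.

(** On leading terms a finite difference of step c acts as c times the
    derivative. *)
Lemma coefmx_diff c S n : sizemx_le S n.+2 ->
  coefmx n (shiftmx c S - S) = (c *+ n.+1) *: coefmx n.+1 S.
Proof.
move=> h; apply/matrixP => i j; rewrite !mxE coefB (coef_shift _ _ (h i j)).
rewrite 2!big_ord_recr /= subnn binn mulr1 big1 ?add0r.
  by rewrite subSn // subnn expr1 binSn addrAC subrr add0r mulrC.
by move=> l _; rewrite bin_small // mulr0n mulr0.
Qed.

End finite_difference.

(** * Commutation with powers of 1 + B *)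

Section ring_identities.
Variables (A : pzRingType) (B J X h G : A).
Hypothesis BJ : B * J = J * B + B.
Hypothesis BX : B * X = X * B + h.
Hypothesis hB : h * B = B * h + B *+ 2.
Hypothesis EG : (1 + B) * G = B.
Hypothesis GE : G * (1 + B) = B.

(** Here G is B (1 + B)^-1, the derivative of log (1 + t) at B multiplied by B;
    as J acts on powers of B as minus the Euler derivation, conjugating it by
    (1 + B)^y subtracts y G. *)
Lemma J_expE y : J * (1 + B) ^+ y = (1 + B) ^+ y * (J - G *+ y).
Proof.
elim: y => [|y IH]; first by rewrite !expr0 mulr1 mul1r mulr0n subr0.
rewrite exprSr mulrA IH -!mulrA; congr (_ * _).
rewrite mulrBl mulrnAl GE mulrBr mulrnAr EG mulrDr mulrDl mulr1 mul1r BJ.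
by rewrite mulrS opprD !addrA addrK.
Qed.

(** The iterated commutators of X with B are h, then a multiple of B, then 0, so
    conjugation by (1 + B)^y makes X quadratic in y. The extra factor 1 + B
    leaves G as the only trace of (1 + B)^-1. *)
Lemma X_expE y : X * (1 + B) ^+ y.+1 =
  (1 + B) ^+ y * (X * (1 + B) - h *+ y - G *+ (y * y.+1)).
Proof.
elim: y => [|y IH]; first by rewrite mulr0n !subr0 expr0 mul1r.
rewrite exprSr mulrA IH [in RHS]exprSr -!mulrA; congr (_ * _).
have XE : (1 + B) * X = X * (1 + B) + h.
  by rewrite mulrDl mulrDr mul1r mulr1 BX addrA.
have hE : h * (1 + B) = (1 + B) * h + B *+ 2.
  by rewrite mulrDl mulrDr mul1r mulr1 hB addrA.
rewrite !mulrBl !mulrBr !mulrnAl !mulrnAr GE EG hE [(1 + B) * (X * _)]mulrA XE.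
rewrite [(_ + h) * _]mulrDl hE mulrnDl -mulrnA.
rewrite mulrS mulrSr -!mulrA.
move: (X * _) ((1 + B) * h) => u v.
have -> : (y.+1 * y.+2 = y * y.+1 + (2 * y + 2))%N by lia.
rewrite !mulrnDr !opprD !addrA.
rewrite [v *+ _]mulrS opprD !mulr0n !subr0 !addr0 !addrA.
(* v and the two isolated copies of B meet their opposites *)
rewrite [RHS](ACl (2*5*3*10*4*11*1*6*8*9*7)) /=.
by rewrite subrr add0r subrr add0r subrr add0r.
Qed.

End ring_identities.

(** * Lower unitriangular matrices *)

Section lower_unitriangular.
Variables (K : comUnitRingType) (N : nat).
Implicit Types L V : 'M[K]_N.

Lemma ord_ltF (i j : 'I_N) : (i < j)%N -> (i == j) = false.
Proof. by move=> ij; apply/negbTE; rewrite -val_eqE neq_ltn ij. Qed.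

Definition lower_unitri L := forall i j : 'I_N, (i <= j)%N -> L i j = (i == j)%:R.

Lemma lower_unitriM L V : lower_unitri L -> lower_unitri V -> lower_unitri (L *m V).
Proof.
move=> hL hV i j ij; rewrite mxE (bigD1 i) //= big1 => [|k ki].
  by rewrite hL // eqxx mul1r addr0 hV.
have [ik|ik] := ltnP i k; first by rewrite (hL _ _ (ltnW ik)) eq_sym (negbTE ki) mul0r.
by rewrite (hV k j (leq_trans ik ij)) ord_ltF ?mulr0 // (leq_trans _ ij) // ltn_neqAle ik andbT.
Qed.

Lemma lower_unitri1 : lower_unitri 1%:M.
Proof. by move=> i j _; rewrite mxE. Qed.

Lemma lower_unitri_unit L : lower_unitri L -> L \in unitmx.
Proof.
move=> hL; rewrite unitmxE (det_trig (A := L)).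
  by rewrite big1 ?unitr1 // => i _; rewrite hL // eqxx.
by apply/is_trig_mxP => i j ij; rewrite hL ?(ltnW ij) // ord_ltF.
Qed.

(** Forward substitution: row i of L *m invmx L = 1 determines row i of the
    inverse from the previous ones. *)
Lemma lower_unitri_inv L : lower_unitri L -> lower_unitri (invmx L).
Proof.
move=> hL i j; have [n] := ubnP (val i); elim: n i => // n IH i; rewrite ltnS => ni ij.
have /matrixP /(_ i j) := mulmxV (lower_unitri_unit hL).
rewrite !mxE (bigD1 i) //= hL // eqxx mul1r big1 ?addr0 // => k ki.
have [ik|ik] := ltnP i k; first by rewrite (hL _ _ (ltnW ik)) eq_sym (negbTE ki) mul0r.
have {}ik : (k < i)%N by rewrite ltn_neqAle ik andbT.
rewrite (IH k) ?(leq_trans ik) // ?(ltnW (leq_trans ik ij)) //.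
by rewrite (ord_ltF (leq_trans ik ij)) mulr0.
Qed.

End lower_unitriangular.

(** * Triangular Toeplitz matrices scaled by mu *)

Section toeplitz.
Variables (R : realType) (N : nat) (mu : 'I_N -> R).
Hypothesis mu_gt0 : forall j, 0 < mu j.
Local Notation C := R[i].

Lemma mu_neq0 j : mu j != 0. Proof. by rewrite gt_eqF. Qed.

(** The conjugate by diag (mu) of c(S), where S is the lower shift and c stands
    for the power series with these coefficients: matrix products are products
    of series. Both L_0 and the powers of 1 + A are of this form. *)
Definition scaled_toeplitz (c : nat -> R) : 'M[C]_N :=
  \matrix_(j, k) (if (k <= j)%N then (mu j / mu k * c (j - k)%N)%:C else 0).

Lemma scaled_toeplitzM c d :
  scaled_toeplitz c *m scaled_toeplitz d =
  scaled_toeplitz (fun m => \sum_(i < m.+1) c (m - i)%N * d i).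
Proof.
apply/matrixP => j k; rewrite !mxE.
under eq_bigr => l _ do rewrite !mxE.
have [kj|kj] := leqP k j; last first.
  rewrite big1 // => l _; case: leqP => h1; last by rewrite mul0r.
  by case: leqP => h2; [lia | rewrite mulr0].
rewrite -(big_mkord xpredT (fun i => c (j - k - i)%N * d i)).
pose F l := if (k <= l <= j)%N then (mu j / mu k * (c (j - l)%N * d (l - k)%N))%:C else 0.
rewrite (eq_bigr (fun l : 'I_N => F l)); last first.
  move=> l _; rewrite /F andbC; case: leqP => h1; last by rewrite mul0r.
  case: leqP => h2; rewrite ?mulr0 //= -rmorphM; congr (_%:C).
  by field; rewrite !mu_neq0.
rewrite -(big_mkord xpredT F) (@big_cat_nat _ _ _ k) //=; last by rewrite ltnW.
rewrite big_nat big1 ?add0r; last first.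
  by move=> l /andP[_ lk]; rewrite /F leqNgt lk.
rewrite (@big_cat_nat _ _ _ j.+1) ?ltn_ord //=; last by rewrite (leq_trans kj).
rewrite [X in _ + X]big_nat [X in _ + X]big1 ?addr0; last first.
  by move=> l /andP[lj _]; rewrite /F [(l <= j)%N]leqNgt lj andbF.
rewrite mulr_sumr rmorph_sum /= -{1}[k : nat]add0n big_addn subSn // .
rewrite [LHS]big_nat [RHS]big_nat; apply: eq_bigr => l /andP[_ hl].
by rewrite /F leq_addl addnK ifT; [congr ((_ * (c _ * _))%:C); lia | lia].
Qed.

Lemma scaled_toeplitz_comm c d :
  scaled_toeplitz c *m scaled_toeplitz d = scaled_toeplitz d *m scaled_toeplitz c.
Proof.
rewrite !scaled_toeplitzM; congr scaled_toeplitz; apply/funext => m.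
rewrite (reindex_inj rev_ord_inj) /=.
by apply: eq_bigr => i _; rewrite mulrC subSS subKn // -ltnS.
Qed.

Lemma addA_toeplitz : 1%:M + Amx mu = scaled_toeplitz (fun m => (m <= 1)%:R).
Proof.
apply/matrixP => j k; rewrite !mxE.
have [->|jk] := eqVneq j k.
  by rewrite leqnn subnn mulr1 divff ?mu_neq0 // (ltn_eqF (ltnSn _)) addr0.
rewrite add0r; have [->|h] := eqVneq (j : nat) k.+1.
  by rewrite leqnSn subSnn mulr1.
case: leqP => // h2; rewrite leqNgt ltn_subRL addn1.
by rewrite ltn_neqAle eq_sym h ltn_neqAle eq_sym h2 andbT jk mulr0.
Qed.

Lemma expA_toeplitz x : (1%:M + Amx mu) ^+ x = scaled_toeplitz (fun m => 'C(x, m)%:R).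
Proof.
elim: x => [|x IH].
  rewrite expr0; apply/matrixP => j k; rewrite !mxE.
  have [->|jk] := eqVneq j k; first by rewrite leqnn subnn bin0 mulr1 divff ?gt_eqF.
  case: leqP => // h2; rewrite bin0n subn_eq0 leqNgt ltn_neqAle h2 eq_sym andbT jk.
  by rewrite mulr0.
rewrite exprS -mulmxE IH addA_toeplitz scaled_toeplitzM.
congr scaled_toeplitz; apply/funext => -[|m].
  by rewrite big_ord1 !bin0 mulr1.
rewrite big_ord_recr big_ord_recr /= subnn subSnn !mul1r big1 ?add0r.
  by rewrite -natrD addnC -binS.
by move=> i _; rewrite leqNgt ltn_subRL addn1 ltnS ltn_ord mul0r.
Qed.

Lemma L0_toeplitz a : L0mx a mu = scaled_toeplitz (fun m => (- a) ^+ m / (m`!)%:R).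
Proof. by apply/matrixP => j k; rewrite !mxE. Qed.

Lemma mpolyfun_expA : mpolyfun (fun x => (1%:M + Amx mu) ^+ x).
Proof.
move=> j k; under eq_fun => x do rewrite expA_toeplitz mxE; case: leqP => _.
  have [p hp] := polyfunM (polyfun_cst (mu j / mu k)%:C) (polyfun_bin R (j - k)).
  by exists p => x; rewrite -hp rmorphM /= rmorph_nat.
exact: polyfun_cst.
Qed.

Lemma lower_unitri_addA : lower_unitri (1%:M + Amx mu).
Proof.
move=> i j ij; rewrite !mxE ltn_eqF ?addr0 //.
Qed.

Lemma lower_unitri_expA x : lower_unitri ((1%:M + Amx mu) ^+ x).
Proof.
elim: x => [|x IH]; first by rewrite expr0; exact: lower_unitri1.
by rewrite exprS; exact: (lower_unitriM lower_unitri_addA IH).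
Qed.

Lemma lower_unitri_L0 a : lower_unitri (L0mx a mu).
Proof.
move=> i j ij; rewrite mxE; have [ji|ji] := leqP j i.
  have -> : i = j by apply/val_inj/eqP; rewrite eqn_leq ij.
  by rewrite subnn expr0 fact0 divr1 mulr1 divff ?mu_neq0 // eqxx.
by rewrite ord_ltF.
Qed.

End toeplitz.

(** * Conjugate transposes *)

Section adjoint.
Variables (R : realType) (N : nat).
Local Notation C := R[i].

Lemma adjmxE (K : 'M[C]_N) i j : (K ^t*) i j = (K j i)^*.
Proof. by rewrite !mxE. Qed.

Lemma conj_real (r : R) : (r%:C)^* = r%:C.
Proof. by rewrite conj_Creal // complex_real. Qed.

Lemma adjmxM (K L : 'M[C]_N) : (K *m L) ^t* = L ^t* *m K ^t*.
Proof. by rewrite trmx_mul map_mxM. Qed.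

Lemma adjmx1 : (1%:M : 'M[C]_N) ^t* = 1%:M.
Proof. by rewrite trmx1 map_mx1. Qed.

Lemma adjmxD (K L : 'M[C]_N) : (K + L) ^t* = K ^t* + L ^t*.
Proof. by rewrite linearD map_mxD. Qed.

Lemma adjmxX (K : 'M[C]_N) n : (K ^+ n) ^t* = (K ^t*) ^+ n.
Proof.
elim: n => [|n IH]; first by rewrite !expr0 adjmx1.
by rewrite exprSr exprS -!mulmxE adjmxM IH.
Qed.

Lemma adjmxK (K : 'M[C]_N) : (K ^t*) ^t* = K.
Proof. by apply/matrixP => i j; rewrite !adjmxE conjCK. Qed.

End adjoint.

(** * Pearson equations for the weight *)

Section scaling.
Variables (F : fieldType) (N : nat).
Implicit Types X Y : 'M[F]_N.

Lemma scale_combination X Y (a c x l : F) :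
  a *: (x *: (c *: (X - l *: Y)) + x ^+ 2 *: (- (c *: Y))) =
  x *: ((a * c) *: (X - (x + l) *: Y)).
Proof. by apply/matrixP => i j; rewrite !mxE; ring. Qed.

End scaling.

Section model.
Variables (R : realType) (N : nat) (a : R) (mu : 'I_N -> R) (delta : nat -> 'I_N -> R).
Hypothesis a_gt0 : 0 < a.
Hypothesis mu_gt0 : forall j, 0 < mu j.
Hypothesis mu_def : forall j k : 'I_N, (mu j / mu k) ^+ 2 =
   a ^ (k%:Z - j%:Z) * ((N - k.+1)`!)%:R / ((N - j.+1)`!)%:R.
Hypothesis delta_def : forall (lam : nat) (k : 'I_N),
   delta lam k = (a / 2) ^+ lam * ((lam + k)`!)%:R / (k`!)%:R.
Local Notation C := R[i].
Local Notation A := (Amx mu).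
Local Notation B := (A ^t*).
Local Notation J := (Jmx R N).
Local Notation T lam := (Tmx (delta lam)).

Let a_neq0 : a != 0. Proof. exact: lt0r_neq0. Qed.

Lemma adjAE i j : B i j = if j == i.+1 :> nat then (mu j / mu i)%:C else 0.
Proof. by rewrite adjmxE mxE; case: eqP => _; rewrite ?conj_real ?conjC0. Qed.

Lemma mu_step (i k : 'I_N) : k = i.+1 :> nat ->
  mu k / mu i * (mu k / mu i) = (N - i.+1)%:R / a.
Proof.
move=> ki; rewrite -expr2 mu_def ki.
have -> : i%:Z - i.+1%:Z = - 1 by lia.
have -> : (N - i.+1 = (N - i.+2).+1)%N by have := ltn_ord k; lia.
rewrite factS natrM exprN1.
have h : ((N - i.+2)`!)%:R != 0 :> R by rewrite pnatr_eq0 -lt0n fact_gt0.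
by field; rewrite h a_neq0.
Qed.

Lemma adjA_A : B *m A = diag_mx (\row_i ((N - i.+1)%:R / a)%:C).
Proof.
apply/matrixP => i j; rewrite !mxE.
under eq_bigr => k _ do rewrite adjAE mxE.
have [lt|ge] := ltnP i.+1 N; last first.
  rewrite big1 => [|k _]; last first.
    by rewrite ifF ?mul0r //; apply/eqP => h; have := ltn_ord k; rewrite h ltnNge ge.
  by have -> : (N - i.+1 = 0)%N; [lia | rewrite mul0r mul0rn].
rewrite (bigD1 (Ordinal lt)) //= big1 => [|k ki]; last first.
  by rewrite ifF ?mul0r //; apply: contraNF ki => /eqP h; apply/eqP/val_inj.
rewrite eqxx addr0 eqSS val_eqE; have [<-|_] := eqVneq i j; last by rewrite mulr0.
by rewrite -rmorphM /= mu_step.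
Qed.

Lemma A_adjA : A *m B = diag_mx (\row_i ((i != 0 :> nat)%:R * (N - i)%:R / a)%:C).
Proof.
apply/matrixP => i j; rewrite !mxE.
under eq_bigr => k _ do rewrite adjAE mxE.
have [i0|i0] := eqVneq (i : nat) 0%N.
  by rewrite !mul0r mul0rn big1 // => k _; rewrite i0 mul0r.
have [k0 iE] : exists k0 : 'I_N, i = k0.+1 :> nat.
  have lt : (i.-1 < N)%N by have := ltn_ord i; lia.
  by exists (Ordinal lt); rewrite /= prednK // lt0n.
rewrite (bigD1 k0) //= big1 => [|k ki]; last first.
  rewrite ifF ?mul0r //; apply: contraNF ki => /eqP h; apply/eqP/val_inj => /=.
  by apply: succn_inj; rewrite -h iE.
rewrite -iE eqxx addr0 val_eqE eq_sym; have [<-|ne] := eqVneq i j; last by rewrite mulr0.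
by rewrite -rmorphM /= (mu_step iE) iE mul1r.
Qed.

Lemma mxJ (K : 'M[C]_N) i j : (K *m J) i j = K i j * j.+1%:R.
Proof. by rewrite mul_mx_diag !mxE. Qed.

Lemma Jmx_mul (K : 'M[C]_N) i j : (J *m K) i j = i.+1%:R * K i j.
Proof. by rewrite mul_diag_mx !mxE. Qed.

Lemma adjA_J : B *m J = J *m B + B.
Proof.
apply/matrixP => i j; rewrite mxJ [RHS]mxE Jmx_mul adjAE.
case: eqP => [->|_]; last by rewrite mul0r mulr0 addr0.
by rewrite -[in RHS](mul1r (_%:C)) mulrA mulr1 -mulrDl natr1 mulrC.
Qed.

(** The matrices B, sl2_h and sl2_X form an sl2 triple. *)
Definition sl2_X : 'M[C]_N := a%:C *: (A *m J).
Definition sl2_h : 'M[C]_N := (N.+1%:R)%:M - J *+ 2.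

(** Once J is moved to the right of B both products are diagonal, and the claim
    in row i is (N-1-i) (i+1) = (N-i) i + (N-1-2i). *)
Lemma adjA_sl2_X : B *m sl2_X = sl2_X *m B + sl2_h.
Proof.
rewrite /sl2_X -scalemxAr -scalemxAl mulmxA adjA_A -mulmxA.
have -> : J *m B = B *m J - B by rewrite adjA_J addrK.
rewrite mulmxBr mulmxA A_adjA -[X in _ - X]mulmx1 -mulmxBr !mul_diag_mx.
apply/matrixP => i j.
rewrite !mxE; have [_|_] := eqVneq i j; last first.
  by rewrite !mulr0n !(subrr, mulr0, addr0, subr0).
have e : a * ((N - i.+1)%:R / a * i.+1%:R) =
    a * ((i != 0 :> nat)%:R * (N - i)%:R / a * (i.+1%:R - 1)) +
    (N.+1%:R - (i.+1%:R + i.+1%:R)).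
  have -> : (N - i = (N - i.+1).+1)%N by have := ltn_ord i; lia.
  have -> : N.+1%:R = (N - i.+1)%:R + i%:R + 2 :> R.
    by rewrite -!natrD; congr (_%:R); have := ltn_ord i; lia.
  by case: (i : nat) => [|k] /=; rewrite -!natr1; field.
have := congr1 (real_complex R) e.
by rewrite !mulr1n !(rmorphD, rmorphN, rmorphM, rmorph_nat, rmorph1).
Qed.

Lemma sl2_h_adjA : sl2_h *m B = B *m sl2_h + B *+ 2.
Proof.
rewrite /sl2_h mulmxBl mulmxBr scalar_mxC mulr2n mulmxDl mulmxDr.
have -> : J *m B = B *m J - B by rewrite adjA_J addrK.
move: (B *m J) (B *m _) => u v.
by apply/matrixP => i j; rewrite !mxE; ring.
Qed.

(** This is B (1 + B)^-1; as 1 minus the inverse of a unitriangular matrix it is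
    visibly strictly triangular. *)
Definition Gmx : 'M[C]_N := 1%:M - (invmx (1%:M + A)) ^t*.

Lemma adj_addA : (1%:M + A) ^t* = 1%:M + B.
Proof. by rewrite adjmxD adjmx1. Qed.

Lemma addB_G : (1%:M + B) *m Gmx = B.
Proof.
rewrite /Gmx mulmxBr mulmx1 -adj_addA -adjmxM mulVmx; last first.
  exact/lower_unitri_unit/lower_unitri_addA.
by rewrite adjmx1 adj_addA addrAC subrr add0r.
Qed.

Lemma G_addB : Gmx *m (1%:M + B) = B.
Proof.
rewrite /Gmx mulmxBl mul1mx -adj_addA -adjmxM mulmxV; last first.
  exact/lower_unitri_unit/lower_unitri_addA.
by rewrite adjmx1 adj_addA addrAC subrr add0r.
Qed.

(** The ratio of delta (lam+1) to delta lam is affine in the index; this is what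
    makes the coefficients of the Pearson equations polynomial in x. *)
Lemma Tmx_succ lam :
  T lam.+1 = (a / 2)%:C *: (T lam *m (lam%:R%:M + J)).
Proof.
rewrite /Tmx mul_diag_mx; apply/matrixP => i j; rewrite !mxE.
have [_|_] := eqVneq i j; last by rewrite !mulr0n addr0 !mulr0.
rewrite !mulr1n !delta_def.
have e : (a / 2) ^+ lam.+1 * (lam.+1 + i)`!%:R / i`!%:R =
    a / 2 * ((a / 2) ^+ lam * (lam + i)`!%:R / i`!%:R * (lam%:R + i.+1%:R)).
  have h : i`!%:R != 0 :> R by rewrite pnatr_eq0 -lt0n fact_gt0.
  by rewrite exprS addSn factS natrM -addnS natrD; field.
rewrite e rmorphM; congr (_ * _); rewrite rmorphM; congr (_ * _).
by rewrite rmorphD !rmorph_nat.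
Qed.

Lemma A_Tmx_succ lam : A *m T lam.+1 = 2^-1 *: (T lam *m sl2_X).
Proof.
rewrite /sl2_X -scalemxAr scalerA mulmxA mul_mx_diag /Tmx mul_diag_mx.
apply/matrixP => i j; rewrite [RHS]mxE mxJ !mxE.
case: eqP => [ij|_]; last by rewrite mulr0 !mul0r mulr0.
rewrite !delta_def ij.
have e : (a / 2) ^+ lam.+1 * (lam.+1 + j)`!%:R / j`!%:R =
   2^-1 * a * ((a / 2) ^+ lam * (lam + j.+1)`!%:R / j.+1`!%:R * j.+1%:R).
  have h : j`!%:R != 0 :> R by rewrite pnatr_eq0 -lt0n fact_gt0.
  have h2 : j.+1%:R != 0 :> R by rewrite pnatr_eq0.
  rewrite exprS addSn addnS [j.+1`!]factS natrM.
  by move: (j.+1%:R) h2 => w h2; field; rewrite h h2.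
have e2 : (2^-1)%:C = 2^-1 :> C by rewrite fmorphV rmorph_nat.
by rewrite e !rmorphM /= !rmorph_nat e2; ring.
Qed.

(** The weight without its Poisson factor a^x / x!. *)
Definition weight_core lam x : 'M[C]_N :=
  (1%:M + A) ^+ (x + lam) *m T lam *m (1%:M + B) ^+ (x + lam).

Lemma J_expB y : J *m (1%:M + B) ^+ y = (1%:M + B) ^+ y *m (J - Gmx *+ y).
Proof. exact: (J_expE adjA_J addB_G G_addB). Qed.

Lemma X_expB y : sl2_X *m (1%:M + B) ^+ y.+1 =
  (1%:M + B) ^+ y *m (sl2_X *m (1%:M + B) - sl2_h *+ y - Gmx *+ (y * y.+1)).
Proof. exact: (X_expE adjA_sl2_X sl2_h_adjA addB_G G_addB). Qed.

(** The left-hand side is weight_core lam.+1 at x - 1, in a form that also makes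
    sense for x = 0. *)
Lemma pearson_back lam x :
  (1%:M + A) ^+ (x + lam) *m T lam.+1 *m (1%:M + B) ^+ (x + lam) =
  weight_core lam x *m ((a / 2)%:C *: (lam%:R%:M + J - Gmx *+ (x + lam))).
Proof.
rewrite Tmx_succ -!scalemxAr -scalemxAl /weight_core -!mulmxA; congr (_ *: (_ *m (_ *m _))).
by rewrite mulmxDl J_expB -scalar_mxC -mulmxDr addrA.
Qed.

(** With these coefficients, the matrices x / a times weight_core lam.+1 (x - 1)
    and weight_core lam.+1 x are weight_core lam x multiplied on the right by
    Theta1 x + Theta2 x^2 and by Phi0 + Phi1 x + Theta2 x^2. The coincidence of
    the coefficients of x^2 is what bounds the degree in sizemx_parts. *)
Definition Theta1 lam : 'M[C]_N := 2^-1 *: (lam%:R%:M + J - Gmx *+ lam).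
Definition Theta2 : 'M[C]_N := - (2^-1 *: Gmx).
Definition Phi0 lam : 'M[C]_N :=
  (a / 2)%:C *: ((1%:M + B) *m (lam%:R%:M + J) - B *+ lam.+1) +
  2^-1 *: (sl2_X *m (1%:M + B) - sl2_h *+ lam - Gmx *+ (lam * lam.+1)).
Definition Phi1 lam : 'M[C]_N :=
  - ((a / 2)%:C *: B) - 2^-1 *: (sl2_h + Gmx *+ lam.*2.+1).

Lemma pearson_fwd lam x :
  weight_core lam.+1 x =
  weight_core lam x *m (Phi0 lam + x%:R *: Phi1 lam + x%:R ^+ 2 *: Theta2).
Proof.
rewrite /weight_core !addnS exprSr -mulmxE.
have -> : (1%:M + A) ^+ (x + lam) *m (1%:M + A) *m T lam.+1 =
    (1%:M + A) ^+ (x + lam) *m T lam *m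
      ((a / 2)%:C *: (lam%:R%:M + J) + 2^-1 *: sl2_X).
  rewrite -!mulmxA; congr (_ *m _).
  by rewrite mulmxDl mul1mx A_Tmx_succ Tmx_succ [RHS]mulmxDr -!scalemxAr.
rewrite -!mulmxA; do 2 congr (_ *m _).
set y := (x + lam)%N.
rewrite mulmxDl -scalemxAl -scalemxAl X_expB mulmxDl J_expB -scalar_mxC -mulmxDr.
rewrite exprSr -mulmxE -mulmxA addrA mulmxBr.
rewrite -[Gmx *+ y.+1]scaler_nat -[in X in X + _]scalemxAr addB_G scaler_nat.
rewrite scalemxAr [X in _ + X]scalemxAr -mulmxDr; congr (_ *m _).
rewrite /Phi0 /Phi1 /Theta2 /y.
move: (B) Gmx sl2_h (sl2_X *m _) (_ *m (_ + J)) => b g h v u.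
have -> : (a / 2)%:C = a%:C * 2^-1 by rewrite rmorphM fmorphV rmorph_nat.
apply/matrixP => i j; rewrite !(mxE, mulmxnE).
rewrite -mul2n; move: (2^-1) => c.
ring.
Qed.

Lemma mpolyfun_weight_core lam : mpolyfun (weight_core lam).
Proof.
have h : mpolyfun (fun x => (1%:M + A) ^+ (x + lam)).
  elim: lam => [|lam IH].
    by under eq_fun do rewrite addn0; exact: mpolyfun_expA.
  by under eq_fun do rewrite addnS; exact: (mpolyfunS IH).
apply: mpolyfunM; first by apply: mpolyfunM => //; exact: mpolyfun_cst.
have -> : (fun x => (1%:M + B) ^+ (x + lam)) = (fun x => ((1%:M + A) ^+ (x + lam)) ^t*).
  by apply/funext => x; rewrite adjmxX adj_addA.
exact: mpolyfun_adj.
Qed.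

Lemma weight_coreE lam x :
  weight a mu delta lam x = (a ^+ x / (x`!)%:R)%:C *: weight_core lam x.
Proof. by []. Qed.

Lemma mxevalXn k (S : 'M[{poly C}]_N) x : mxeval ('X^k *: S) x = x ^+ k *: mxeval S x.
Proof. by apply/matrixP => i j; rewrite !mxE hornerM hornerXn. Qed.

Lemma coefmxXn n k (S : 'M[{poly C}]_N) :
  coefmx n ('X^k *: S) = if (n < k)%N then 0 else coefmx (n - k) S.
Proof. by apply/matrixP => i j; rewrite !mxE coefXnM; case: ifP; rewrite mxE. Qed.

(** The adjoint of the leading coefficient of Rback - Rfwd below when q is monic
    of degree m: the last term comes from the leading term -m x^(m-1) of
    q(x-1) - q(x). *)
Definition ladder_mx lam m : 'M[C]_N := Theta1 lam - Phi1 lam - m%:R *: Theta2.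

Lemma adj_mxevalXn k (S : 'M[{poly C}]_N) (K : 'M[C]_N) x :
  (mxeval ('X^k *: (S *m polymx (K ^t*))) x%:R) ^t* =
  x%:R ^+ k *: (K *m (mxeval S x%:R) ^t*).
Proof.
rewrite mxevalXn mxevalM mxeval_polymx -natrX.
have -> (n : nat) (L : 'M[C]_N) : (n%:R *: L) ^t* = n%:R *: L ^t*.
  by apply/matrixP => i j; rewrite !mxE rmorphM /= conjC_nat.
by rewrite adjmxM adjmxK.
Qed.

Lemma adj_ladder_mx lam m :
  (ladder_mx lam m) ^t* = (Theta1 lam) ^t* - (Phi1 lam) ^t* - m%:R *: Theta2 ^t*.
Proof.
rewrite /ladder_mx; move: (Theta1 lam) (Phi1 lam) Theta2 => u v w.
by apply/matrixP => i j; rewrite !mxE !rmorphB /= rmorphM /= conjC_nat.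
Qed.

(** * Summation by parts and the ladder relation *)

Section parts.
Variables (lam : nat) (p q : 'M[{poly C}]_N).

(** Rback and Rfwd carry the right factors Theta and Phi of the Pearson equations
    over to the second argument of the inner product, hence the adjoints. *)
Definition Rback : 'M[{poly C}]_N :=
  'X^1 *: (shiftmx (-1) q *m polymx ((Theta1 lam) ^t*)) +
  'X^2 *: (shiftmx (-1) q *m polymx (Theta2 ^t*)).
Definition Rfwd : 'M[{poly C}]_N :=
  'X^0 *: (q *m polymx ((Phi0 lam) ^t*)) + 'X^1 *: (q *m polymx ((Phi1 lam) ^t*)) +
  'X^2 *: (q *m polymx (Theta2 ^t*)).

Lemma Rback_adj x : (mxeval Rback x%:R) ^t* =
  (x%:R *: Theta1 lam + x%:R ^+ 2 *: Theta2) *m (mxeval q (x%:R - 1)) ^t*.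
Proof.
rewrite /Rback mxevalD adjmxD 2!adj_mxevalXn mxeval_shiftmx expr1.
by move: (Theta1 lam) Theta2 (map_mx _ _) => u v w; rewrite mulmxDl -!scalemxAl.
Qed.

Lemma Rfwd_adj x : (mxeval Rfwd x%:R) ^t* =
  (Phi0 lam + x%:R *: Phi1 lam + x%:R ^+ 2 *: Theta2) *m (mxeval q x%:R) ^t*.
Proof.
rewrite /Rfwd mxevalD mxevalD adjmxD adjmxD 3!adj_mxevalXn expr1 expr0 scale1r.
move: (Phi0 lam) (Phi1 lam) Theta2 (map_mx _ _) => u v t w.
by rewrite !mulmxDl -!scalemxAl.
Qed.

Lemma parts_fwd : mxip (weight a mu delta lam.+1) p q =
  mxip (weight a mu delta lam) p Rfwd.
Proof.
rewrite (mxip_mxpsum (weight_coreE _)) (mxip_mxpsum (weight_coreE lam)).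
congr mxpsum; apply/funext => x.
rewrite pearson_fwd Rfwd_adj; move: (weight_core _ _) (_ + _ + _) => u v.
by rewrite !mulmxA.
Qed.

Lemma Theta_eq x : a%:C *: (x%:R *: Theta1 lam + x%:R ^+ 2 *: Theta2) =
  x%:R *: ((a / 2)%:C *: (lam%:R%:M + J - Gmx *+ (x + lam))).
Proof.
have -> : (a / 2)%:C = a%:C * 2^-1 by rewrite rmorphM fmorphV rmorph_nat.
rewrite /Theta1 /Theta2; move: Gmx (_ + J) (a%:C) (2^-1) => u v b c.
rewrite -[u *+ lam]scaler_nat -[u *+ _]scaler_nat natrD; exact: scale_combination.
Qed.

(** The shift rule moves the shift from p to the weight and to q. *)
Lemma parts_back : mxip (weight a mu delta lam.+1) (shiftmx 1 p) q =
  mxip (weight a mu delta lam) p Rback.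
Proof.
rewrite (mxip_mxpsum (weight_coreE _)) (mxip_mxpsum (weight_coreE lam)).
have a0 : a%:C != 0 by rewrite fmorph_eq0.
set F := fun x => _; set G := fun x => _.
have hF : mpolyfun F by apply: mpolyfun_ip; exact: mpolyfun_weight_core.
have hG : mpolyfun G by apply: mpolyfun_ip; exact: mpolyfun_weight_core.
suff e : mxpsum a (fun x => x%:R *: F x.-1) = mxpsum a (fun x => a%:C%:M *m G x).
  by apply: (scalerI a0); apply: etrans (esym (mxpsum_shift a hF)) (etrans e _);
    apply: etrans (mxpsumMl a _ hG) (mul_scalar_mx _ _).
congr mxpsum; apply/funext => x; rewrite mul_scalar_mx /G Rback_adj.
rewrite [RHS]scalemxAr [X in _ = _ *m X]scalemxAl Theta_eq /F.
(* at 0 the predecessor is meaningless, but the factor x kills both sides *)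
case: x => [|x]; first by rewrite !scale0r mul0mx mulmx0.
rewrite [_.-1]/= mxeval_shiftmx natr1 -[X in mxeval q (X - 1)]natr1 addrK.
have -> : weight_core lam.+1 x =
    (1%:M + A) ^+ (x.+1 + lam) *m T lam.+1 *m (1%:M + B) ^+ (x.+1 + lam).
  by rewrite /weight_core addnS.
rewrite pearson_back; move: (weight_core _ _) (_ *: (_ - _)) => u v.
by rewrite -!scalemxAl -!scalemxAr !mulmxA.
Qed.

Lemma coefmx_term n k (S : 'M[{poly C}]_N) (K : 'M[C]_N) :
  coefmx n ('X^k *: (S *m polymx K)) =
  if (n < k)%N then 0 else coefmx (n - k) S *m K.
Proof. by rewrite coefmxXn coefmxMr. Qed.

(** The terms in x^2 share the coefficient Theta2 and combine into a finite
    difference of q. *)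
Lemma coefmx_parts n :
  coefmx n.+1 (Rback - Rfwd) =
  coefmx n (shiftmx (-1) q) *m (Theta1 lam) ^t* +
  (if n is k.+1 then coefmx k (shiftmx (-1) q - q) else 0) *m Theta2 ^t*
  - coefmx n.+1 q *m (Phi0 lam) ^t* - coefmx n q *m (Phi1 lam) ^t*.
Proof.
rewrite coefmxB 3!coefmxD 5!coefmx_term subn0 !subSS subn0 /=.
move: (map_mx _ _) (map_mx _ _) (map_mx _ _) (map_mx _ _) => u v w z.
case: n => [|k] /=; first by rewrite mul0mx !addr0 opprD addrA.
rewrite subn1 /= coefmxB mulmxBl !opprD !addrA.
by rewrite [LHS](ACl (1*2*5*3*4)).
Qed.

Lemma sizemx_parts m : sizemx_le q m.+1 -> sizemx_le (Rback - Rfwd) m.+2.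
Proof.
move=> hq; have hs := sizemx_shiftmx (-1) hq; have hd := sizemx_diff (-1) hq.
apply/sizemx_leP => -[|[|k]] //; rewrite !ltnS => mk; rewrite coefmx_parts.
have /sizemx_leP -> // := hs; have /sizemx_leP -> // := hd.
have /sizemx_leP h := hq; rewrite !h ?ltnS ?leqW //.
by rewrite !mul0mx !subr0 addr0.
Qed.

Lemma coefmx_parts_lead m : sizemx_le q m.+1 -> coefmx m q = 1%:M ->
  coefmx m.+1 (Rback - Rfwd) = (ladder_mx lam m) ^t*.
Proof.
move=> hq q1; rewrite coefmx_parts coefmx_shiftmx_lead // q1.
have /sizemx_leP -> // := hq; rewrite mul0mx subr0 !mul1mx.
rewrite [RHS]adj_ladder_mx addrAC; congr (_ + _); case: m hq q1 => [|k] hq q1.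
  by rewrite mul0mx scale0r oppr0.
rewrite coefmx_diff // q1 -scalemxAl mul1mx mulNrn.
by rewrite scaleNr.
Qed.

End parts.

(** Both sides are the inner product for lam.+1 of P m.+1 (x+1) - P m.+1 (x) with
    Q m. *)
Lemma ladder lam m (P Q : nat -> 'M[{poly C}]_N) :
  monic_orthogonal (weight a mu delta lam) P ->
  monic_orthogonal (weight a mu delta lam.+1) Q ->
  m.+1%:R *: mxip (weight a mu delta lam.+1) (Q m) (Q m) =
  mxip (weight a mu delta lam) (P m.+1) (P m.+1) *m ladder_mx lam m.
Proof.
move=> hP hQ; have [sP P1] := hP.1 m.+1; have [sQ Q1] := hQ.1 m.
have pol := mpolyfun_weight_core.
have := mxip_lead_l (pol _) (weight_coreE _) hQ (sizemx_diff 1 sP).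
rewrite coefmx_diff // [coefmx _ _]P1 -scalemxAl mul1mx => <-.
rewrite (mxipBl (pol _) (weight_coreE _)) parts_back parts_fwd.
rewrite -(mxipBr (pol _) (weight_coreE _)).
rewrite (mxip_lead_r (pol _) (weight_coreE _) hP) ?coefmx_parts_lead ?adjmxK //.
exact: sizemx_parts.
Qed.

Lemma G_upper (i j : 'I_N) : (j <= i)%N -> Gmx i j = 0.
Proof.
move=> ji; rewrite /Gmx !mxE (lower_unitri_inv (lower_unitri_addA mu)) // eq_sym.
by rewrite conjC_nat subrr.
Qed.

(** B and G are strictly upper triangular, so that the diagonal only receives
    (lam + J) / 2 from Theta1 and h / 2 from - Phi1. *)
Lemma ladder_mx_upper lam m (i j : 'I_N) : (j <= i)%N ->
  ladder_mx lam m i j = (i == j)%:R * (2^-1 * (N + lam - j)%:R).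
Proof.
move=> ji; have B0 : B i j = 0 by rewrite adjAE ltn_eqF.
rewrite /ladder_mx /Theta1 /Phi1 /Theta2 /sl2_h; move: B B0 Gmx (G_upper ji) => b b0 g g0.
rewrite !(mxE, mulmxnE) b0 g0.
case: eqVneq => [->|_] /=; last by rewrite !mulr0n; ring.
have -> : (N + lam - j)%:R = N%:R + lam%:R - j%:R :> C.
  by rewrite natrB ?natrD //; have := ltn_ord j; lia.
by rewrite -!natr1; field.
Qed.

End model.

(** * Norms of Charlier polynomials *)

Section charlier.
Variables (R : realType) (a : R).
Local Notation C := R[i].

(** The Charlier polynomial with leading coefficient 1 / m!, that is, the
    coefficient of t^m in exp (- a t) (1 + t)^x. *)
Definition charlier m x : R :=
  \sum_(i < m.+1) 'C(x, m - i)%:R * ((- a) ^+ i / (i`!)%:R).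

Lemma polyfun_real (f : nat -> R) c : polyfun (fun x => (f x)%:C) ->
  polyfun (fun x => (c * f x)%:C).
Proof.
move=> [p hp]; exists (c%:C *: p) => x.
by rewrite hornerZ rmorphM /= hp.
Qed.

Lemma polyfun_charlier m : polyfun (fun x => (charlier m x)%:C).
Proof.
have h (i : 'I_m.+1) :
    polyfun (fun x => ('C(x, m - i)%:R * ((- a) ^+ i / (i`!)%:R))%:C).
  have [p hp] := polyfunM (polyfun_bin R (m - i)) (polyfun_cst ((- a) ^+ i / (i`!)%:R)%:C).
  by exists p => x; rewrite rmorphM rmorph_nat /= hp.
have [p hp] := polyfun_sum (index_enum 'I_m.+1) h.
by exists p => x; rewrite /charlier rmorph_sum /= hp.
Qed.

(** In each term of charlier m.+1 split m.+1 as (m.+1 - i) + i: the first part is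
    absorbed by the binomial coefficient, the second by the factorial. *)
Lemma charlier_rec m x :
  m.+1%:R * charlier m.+1 x = x%:R * charlier m x.-1 - a * charlier m x.
Proof.
have -> : m.+1%:R * charlier m.+1 x =
    \sum_(i < m.+2) (m.+1 - i)%:R * ('C(x, m.+1 - i)%:R * ((- a) ^+ i / (i`!)%:R)) +
    \sum_(i < m.+2) i%:R * ('C(x, m.+1 - i)%:R * ((- a) ^+ i / (i`!)%:R)).
  rewrite /charlier mulr_sumr -big_split; apply: eq_bigr => i _ /=.
  by rewrite -mulrDl -natrD subnK // -ltnS.
congr (_ + _).
  rewrite big_ord_recr /= subnn mul0r addr0 mulr_sumr; apply: eq_bigr => i _.
  by rewrite !mulrA -!natrM mul_bin_diag subSn // -ltnS.
rewrite big_ord_recl mul0r add0r mulr_sumr -sumrN; apply: eq_bigr => i _.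
rewrite lift0 subSS exprS factS natrM.
have h : i`!%:R != 0 :> R by rewrite pnatr_eq0 -lt0n fact_gt0.
have : i.+1%:R != 0 :> R by rewrite pnatr_eq0.
by move: (i.+1%:R) => w h2; field; rewrite h h2.
Qed.

Lemma charlier_diff m x : charlier m.+1 x.+1 = charlier m.+1 x + charlier m x.
Proof.
rewrite /charlier big_ord_recr [X in X + _]big_ord_recr /= subnn !bin0 addrAC; congr (_ + _).
rewrite -big_split; apply: eq_bigr => i _ /=.
by rewrite (subSn (leq_ord i)) binS natrD mulrDl.
Qed.

(** The recurrence rewrites one factor of the square; the shift rule then turns
    its first term into a difference of the other factor, which charlier_diff
    evaluates. *)
Lemma psum_charlier_sq m :
  psum a (fun x => (charlier m x * charlier m x)%:C) = (expR a * (a ^+ m / (m`!)%:R))%:C.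
Proof.
elim: m => [|m IH].
  rewrite expr0 fact0 divr1 mulr1 -psum1; congr psum; apply/funext => x.
  by rewrite /charlier big_ord1 bin0 expr0 fact0 divr1 !mul1r.
pose g m x : C := (charlier m x)%:C.
have pg k : polyfun (g k) := polyfun_charlier k.
have m0 : m.+1%:R != 0 :> C by rewrite pnatr_eq0.
apply: (mulfI m0).
have -> : m.+1%:R * (expR a * (a ^+ m.+1 / (m.+1)`!%:R))%:C =
    a%:C * (expR a * (a ^+ m / (m`!)%:R))%:C.
  rewrite -(rmorph_nat (real_complex R)) -!rmorphM /=; congr (_%:C).
  have h : m`!%:R != 0 :> R by rewrite pnatr_eq0 -lt0n fact_gt0.
  have : m.+1%:R != 0 :> R by rewrite pnatr_eq0.
  by rewrite factS natrM exprS; move: (m.+1%:R) => w h2; field; rewrite h h2.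
have hv : polyfun (fun x => g m x * g m.+1 x.+1).
  by apply: polyfunM => //; apply: polyfunS.
have hgg k l : polyfun (fun x => g k x * g l x) by exact: polyfunM.
rewrite -{}IH -[LHS]psumZ; last first.
  by have [p hp] := hgg m.+1 m.+1; exists p => x; rewrite -hp rmorphM.
have -> : (fun x => m.+1%:R * (charlier m.+1 x * charlier m.+1 x)%:C) =
    (fun x => x%:R * (g m x.-1 * g m.+1 x.-1.+1) + (- a%:C) * (g m x * g m.+1 x)).
  apply/funext => x; rewrite /g -!(rmorph_nat (real_complex R)) -!rmorphM -rmorphN.
  rewrite -rmorphM -rmorphD; congr (_%:C); rewrite [LHS]mulrA charlier_rec.
  by case: x => [|x] /=; ring.
rewrite psumD; last 2 first.
- exact: (polyfun_shift hv).
- by apply: polyfunM => //; exact: polyfun_cst.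
rewrite (psum_shift a hv) psumZ // mulNr -mulrBr; congr (_ * _).
have -> : (fun x => g m x * g m.+1 x.+1) =
    (fun x => g m x * g m.+1 x + (charlier m x * charlier m x)%:C).
  by apply/funext => x; rewrite /g charlier_diff -!rmorphM -rmorphD mulrDr.
rewrite psumD //; first by rewrite addrAC subrr add0r.
by have [p hp] := hgg m m; exists p => x; rewrite -hp rmorphM.
Qed.

End charlier.

(** * Binomial, factorial and Pochhammer identities *)

(** The coefficient of t^j in (1-t)^-(r+1) (1-t)^-(l+1) = (1-t)^-(r+l+2). *)
Lemma bin_convolution r l j :
  (\sum_(k < j.+1) 'C(r + (j - k), j - k) * 'C(l + k, k) = 'C(r + l + j.+1, j))%N.
Proof.
elim: l j => [|l IHl] j.
  elim: j => [|j IHj]; first by rewrite big_ord1 !bin0.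
  rewrite big_ord_recl subn0 bin0 muln1 [X in (_ + X)%N](_ : _ = 'C(r + 0 + j.+1, j)).
    by rewrite !addn0 [in RHS]addnS binS.
  by rewrite -IHj; apply: eq_bigr => i _; rewrite lift0 subSS !binn.
elim: j => [|j IHj]; first by rewrite big_ord1 !bin0.
have -> : 'C(r + l.+1 + j.+2, j.+1) = ('C(r + l + j.+2, j.+1) + 'C(r + l.+1 + j.+1, j))%N.
  by rewrite addnS binS; congr ('C(_, _) + _)%N; lia.
rewrite -IHl -IHj big_ord_recl [X in _ = (X + _)%N]big_ord_recl !bin0 -addnA -big_split /=.
congr (_ + _)%N; apply: eq_bigr => i _.
by rewrite /bump leq0n add1n subSS -mulnDr addnS binS addSnnS.
Qed.

Section poch_fact.
Variable R : realType.

Lemma poch_neg M j : poch (- (M + j)%:R) j * (M`!)%:R = (- 1) ^+ j * ((M + j)`!)%:R :> R.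
Proof.
elim: j => [|j IH]; first by rewrite /poch big_ord0 addn0 expr0.
have -> : poch (- (M + j.+1)%:R) j.+1 = - (M + j.+1)%:R * poch (- (M + j)%:R) j :> R.
  rewrite /poch big_ord_recl addr0; congr (_ * _); apply: eq_bigr => i _.
  by rewrite lift0 addnS -natr1 -[i.+1%:R]natr1; ring.
by rewrite -mulrA IH addnS factS natrM exprS; move: (_%:R) (_%:R) => u v; ring.
Qed.

Lemma poch_pos m k : poch (m + 1)%:R k * (m`!)%:R = ((m + k)`!)%:R :> R.
Proof.
elim: k => [|k IH]; first by rewrite /poch big_ord0 addn0 mul1r.
by rewrite /poch big_ord_recr mulrAC IH addn1 addnS factS natrM mulrC -natrD addSn.
Qed.

End poch_fact.

Lemma Lambdamx_diag (R : realType) N lam n : Lambdamx R N lam n =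
  diag_mx (\row_j (((lam + n + (N - j.+1))`!)%:R / ((lam + (N - j.+1))`!)%:R)).
Proof.
have f0 k : k`!%:R != 0 :> R[i] by rewrite pnatr_eq0 -lt0n fact_gt0.
elim: n => [|n IH].
  rewrite /Lambdamx big_geq //; apply/matrixP => i j; rewrite !mxE addn0 divff //.
rewrite /Lambdamx big_nat_recr //= -/(Lambdamx R N lam n) IH -mulmxE mul_diag_mx.
apply/matrixP => i j; rewrite !mxE.
have [_|_] := eqVneq i j; last by rewrite !mulr0n subrr mulr0.
have hi := ltn_ord i.
have -> : (N + lam + n.+1 = (lam + n + (N - i.+1)).+1 + i.+1)%N by lia.
have -> : (lam + n.+1 + (N - i.+1) = (lam + n + (N - i.+1)).+1)%N by lia.
by rewrite !mulr1n natrD addrK factS natrM mulrAC [X in X / _]mulrC.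
Qed.

Lemma invmx_diag (F : fieldType) N (d : 'rV[F]_N) : (forall i, d 0 i != 0) ->
  invmx (diag_mx d) = diag_mx (\row_i (d 0 i)^-1).
Proof.
move=> d0; have e : diag_mx d *m diag_mx (\row_i (d 0 i)^-1) = 1%:M.
  rewrite mul_diag_mx; apply/matrixP => i j; rewrite !mxE mulrnAr.
  by rewrite divff.
have [u _] := mulmx1_unit e.
by rewrite -[RHS](mulKmx u) e mulmx1.
Qed.

(** * The diagonal matrices D *)

Section main.
Variables (R : realType) (N : nat) (a : R) (mu : 'I_N -> R) (delta : nat -> 'I_N -> R).
Hypothesis a_gt0 : 0 < a.
Hypothesis mu_gt0 : forall j, 0 < mu j.
Hypothesis mu_def : forall j k : 'I_N, (mu j / mu k) ^+ 2 =
   a ^ (k%:Z - j%:Z) * ((N - k.+1)`!)%:R / ((N - j.+1)`!)%:R.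
Hypothesis delta_def : forall (lam : nat) (k : 'I_N),
   delta lam k = (a / 2) ^+ lam * ((lam + k)`!)%:R / (k`!)%:R.
Variables (P : nat -> nat -> 'M[{poly R[i]}]_N).
Hypothesis P_mop : forall lam : nat,
   monic_orthogonal (weight a mu delta lam) (P lam).
Variable D : nat -> nat -> 'M[R[i]]_N.
Hypothesis D_def : forall lam n : nat, is_Dmx a mu delta P lam n (D lam n).
Local Notation C := R[i].
Local Notation A := (Amx mu).
Local Notation B := (A ^t*).
Local Notation J := (Jmx R N).
Local Notation T lam := (Tmx (delta lam)).

Definition Lmx k : 'M[C]_N := invmx (L0mx a mu) *m (1%:M + A) ^+ k.

Lemma lower_unitri_Lmx k : lower_unitri (Lmx k).
Proof.
apply: lower_unitriM; first exact/lower_unitri_inv/lower_unitri_L0.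
exact: lower_unitri_expA.
Qed.

Lemma D_diag lam n i j : i != j -> D lam n i j = 0.
Proof. by case: (D_def lam n) => /is_diag_mxP h _ _ ij; apply: h. Qed.

Lemma mulDmx lam n (M : 'M[C]_N) i j : (D lam n *m M) i j = D lam n i i * M i j.
Proof.
rewrite mxE (bigD1 i) //= big1 ?addr0 // => k ki.
by rewrite D_diag ?mul0r // eq_sym.
Qed.

(** The triangular factor depends on n and lam only through n + lam, so that it is
    the same on both sides of the ladder relation. *)
Lemma Hmx_Lmx lam n : mxip (weight a mu delta lam) (P lam n) (P lam n) =
  Lmx (n + lam) *m D lam n *m (Lmx (n + lam)) ^t*.
Proof.
case: (D_def lam n) => _ _; rewrite /Hmx => ->.
by rewrite /Lmx adjmxM adjmxX adj_addA trmx_inv map_invmx !mulmxA.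
Qed.

(** After cancelling the common left factor L, the ladder relation equates
    D L^t* K with a multiple of D' L^t* . Both L^t* and K are upper triangular and
    the former has unit diagonal, so diagonal entries can be read off. *)
Lemma D_step lam m j :
  D lam m.+1 j j * (2^-1 * (N + lam - j)%:R) = m.+1%:R * D lam.+1 m j j.
Proof.
have := ladder a_gt0 mu_gt0 mu_def delta_def m (P_mop lam) (P_mop lam.+1).
rewrite !Hmx_Lmx -addSnnS; set L := Lmx _; set K := ladder_mx _ _ _ _.
have hL : lower_unitri L by exact: lower_unitri_Lmx.
have hK : forall i : 'I_N, (j <= i)%N -> K i j = (i == j)%:R * (2^-1 * (N + lam - j)%:R).
  by move=> i ij; exact: ladder_mx_upper.
move: L K hL hK => L K hL hK.
rewrite -!mulmxA scalemxAr => /(congr1 (mulmx (invmx L))).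
rewrite !mulKmx ?lower_unitri_unit // => /matrixP /(_ j j).
rewrite mxE !mulDmx !mxE hL // eqxx conjC1 mulr1 => ->; congr (_ * _).
rewrite (bigD1 j) //= big1 => [|k kj].
  by rewrite !mxE hL // hK // eqxx conjC1 !mul1r addr0.
have [jk|jk] := leqP j k; first by rewrite hK // (negbTE kj) mul0r mulr0.
by rewrite !mxE hL ?(ltnW jk) // (negbTE kj) conjC0 mul0r.
Qed.

Lemma H0_weight_core lam : mxip (weight a mu delta lam) (P lam 0) (P lam 0) =
  mxpsum a (weight_core mu delta lam).
Proof.
rewrite (mxip_mxpsum (@weight_coreE _ _ _ _ _ lam)); congr mxpsum; apply/funext => x.
have [sP P1] := (P_mop lam).1 0%N.
have -> : mxeval (P lam 0%N) x%:R = 1%:M.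
  rewrite -P1; apply/matrixP => i j; rewrite !mxE.
  by rewrite [P _ _ _ _]size1_polyC ?hornerC ?coefC.
by rewrite adjmx1 mul1mx mulmx1.
Qed.

(** Multiplying H_0 on the left by the inverse of Lmx lam, and on the right by its
    adjoint, leaves the Poisson sum of g(x) T g(x)^t* , where g(x) = (1 + A)^x L_0
    has Charlier entries. As D is diagonal by hypothesis, norms suffice. *)
Lemma D_zero lam j : D lam 0 j j =
  (expR a * \sum_(l < N | (l <= j)%N)
     (mu j / mu l) ^+ 2 * delta lam l * (a ^+ (j - l) / ((j - l)`!)%:R))%:C.
Proof.
have uL := lower_unitri_unit (lower_unitri_Lmx lam).
pose g x : 'M[C]_N := scaled_toeplitz mu (fun m => charlier a m x).
have gE x : g x = (1%:M + A) ^+ x *m L0mx a mu.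
  by rewrite expA_toeplitz // L0_toeplitz // scaled_toeplitzM.
have L0_comm k : L0mx a mu *m (1%:M + A) ^+ k = (1%:M + A) ^+ k *m L0mx a mu.
  by rewrite expA_toeplitz // L0_toeplitz // scaled_toeplitz_comm.
have g_inv x : invmx (Lmx lam) *m (1%:M + A) ^+ (x + lam) = g x.
  apply: (canLR (mulKmx uL)); rewrite gE /Lmx -mulmxA.
  rewrite [(1%:M + A) ^+ lam *m _]mulmxA mulmxE -exprD -mulmxE addnC -L0_comm.
  by rewrite mulKmx // lower_unitri_unit //; exact: lower_unitri_L0.
have DE : D lam 0%N = mxpsum a (fun x => g x *m T lam *m (g x) ^t*).
  have pom := @mpolyfun_weight_core _ _ _ delta mu_gt0 lam.
  have -> : (fun x => g x *m T lam *m (g x) ^t*) =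
      (fun x => (invmx (Lmx lam) *m weight_core mu delta lam x) *m
        (invmx (Lmx lam)) ^t*).
    apply/funext => x; rewrite -g_inv adjmxM adjmxX adj_addA /weight_core.
    by move: (invmx _) => u; rewrite !mulmxA.
  have pm : mpolyfun (fun x => invmx (Lmx lam) *m weight_core mu delta lam x).
    by apply: mpolyfunM => //; exact: mpolyfun_cst.
  rewrite (mxpsumMr a _ pm) (mxpsumMl a _ pom) -H0_weight_core Hmx_Lmx add0n.
  move: (Lmx lam) uL => L uL; rewrite -!mulmxA mulKmx //.
  by rewrite -adjmxM mulVmx // adjmx1 mulmx1.
rewrite DE mxE mulr_sumr rmorph_sum /=.
pose F (l : 'I_N) x : C := if (l <= j)%N then
  ((mu j / mu l) ^+ 2 * delta lam l *
    (charlier a (j - l) x * charlier a (j - l) x))%:C else 0.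
have -> : (fun x => (g x *m T lam *m (g x) ^t*) j j) = (fun x => \sum_l F l x).
  apply/funext => x; rewrite mxE; apply: eq_bigr => l _.
  rewrite /Tmx mul_mx_diag adjmxE !mxE /F; case: leqP => _; last by rewrite !mul0r.
  by rewrite conj_real -!rmorphM; congr (_%:C); ring.
have sq m : polyfun (fun x => (charlier a m x * charlier a m x)%:C).
  have [p hp] := polyfunM (polyfun_charlier a m) (polyfun_charlier a m).
  by exists p => x; rewrite -hp rmorphM.
rewrite psum_sum; last first.
  move=> l; rewrite /F; case: leqP => _; last exact: polyfun_cst.
  exact: polyfun_real.
rewrite [RHS]big_mkcond /=; apply: eq_bigr => l _; rewrite /F; case: leqP => _.
  rewrite mulrCA rmorphM /= -psum_charlier_sq -psumZ //.
  by congr psum; apply/funext => x; rewrite rmorphM.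
rewrite -[RHS](mul0r (psum a (fun => 1))) -psumZ; last exact: polyfun_cst.
by congr psum; apply/funext => x; rewrite mul0r.
Qed.

Lemma D_zeroE lam j : D lam 0 j j =
  (expR a * (a / 2) ^+ lam * (lam`!)%:R * ('C(N + lam, j))%:R)%:C.
Proof.
rewrite D_zero; congr (_%:C); rewrite -!mulrA; congr (_ * _).
rewrite (eq_bigr (fun l : 'I_N => (a / 2) ^+ lam * (lam`!%:R *
   ('C(N - j.+1 + (j - l), j - l) * 'C(lam + l, l))%:R))).
  rewrite -!mulr_sumr; do 2 congr (_ * _).
  rewrite -natr_sum; congr (_%:R); have := bin_convolution (N - j.+1) lam j.
  rewrite (big_ord_widen N
    (fun l => 'C(N - j.+1 + (j - l), j - l) * 'C(lam + l, l))%N) //.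
  by move=> ->; congr 'C(_, _); have := ltn_ord j; lia.
move=> l lj; rewrite mu_def delta_def natrM.
have f0 n : n`!%:R != 0 :> R by rewrite pnatr_eq0 -lt0n fact_gt0.
have binE n m : 'C(n + m, m)%:R = (n + m)`!%:R / (m`!%:R * n`!%:R) :> R.
  apply: (mulIf (mulf_neq0 (f0 m) (f0 n))); rewrite mulfVK ?mulf_neq0 //.
  by rewrite -!natrM -(bin_fact (leq_addl n m)) addnK.
rewrite !binE.
have -> : (N - l.+1 = N - j.+1 + (j - l))%N by have := ltn_ord j; lia.
have -> : l%:Z - j%:Z = - (j - l)%N%:Z by lia.
rewrite -exprz_inv -exprnP exprVn.
have := expf_neq0 (j - l) (lt0r_neq0 a_gt0).
move: (a ^+ (j - l)) => w w0.
by field; rewrite !f0 w0.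
Qed.

(** Here r stands for N - 1 - j, which avoids truncated subtractions. *)
Definition D_closed r j lam n : R :=
  expR a * (n`!)%:R * a ^+ n * (a / 2) ^+ lam * ((lam + n)`!)%:R *
  ((r + j.+1 + lam + n)`!)%:R * ((lam + r)`!)%:R /
  ((j`!)%:R * ((r + lam + n)`!)%:R * ((lam + n + r.+1)`!)%:R).

Lemma D_closedE lam n (j : 'I_N) :
  D lam n j j = (D_closed (N - j.+1) j lam n)%:C.
Proof.
have f0 k : k`!%:R != 0 :> R by rewrite pnatr_eq0 -lt0n fact_gt0.
have jN := ltn_ord j; set r := (N - j.+1)%N.
have NE : N = (r + j.+1)%N by rewrite /r; lia.
elim: n lam => [|n IH] lam.
  rewrite D_zeroE; congr (_%:C); rewrite /D_closed !addn0 expr0 fact0 !mulr1.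
  have jl : (j <= N + lam)%N by lia.
  have := bin_fact jl; have -> : (N + lam - j = lam + r.+1)%N by lia.
  have -> : (r + j.+1 + lam = N + lam)%N by lia.
  have -> : (r + lam = lam + r)%N by lia.
  by move=> <-; rewrite !natrM; field; rewrite !f0.
have c0 : 2^-1 * (N + lam - j)%:R != 0 :> C.
  by rewrite mulf_neq0 ?invr_eq0 ?pnatr_eq0 // subn_eq0 -ltnNge; lia.
apply: (mulIf c0); rewrite D_step IH.
have -> : 2^-1 * (N + lam - j)%:R = (2^-1 * (N + lam - j)%:R)%:C :> C.
  by rewrite rmorphM fmorphV !rmorph_nat.
rewrite -[n.+1%:R](rmorph_nat (real_complex R)) -!rmorphM; congr (_%:C).
have -> : (N + lam - j = (lam + r).+1)%N by lia.
rewrite /D_closed.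
have -> : (lam.+1 + n = lam + n.+1)%N by lia.
have -> : (r + j.+1 + lam.+1 + n = r + j.+1 + lam + n.+1)%N by lia.
have -> : (r + lam.+1 + n = r + lam + n.+1)%N by lia.
have -> : (lam.+1 + r = (lam + r).+1)%N by lia.
rewrite (factS n) (factS (lam + r)) !natrM !exprS.
have := f0 (lam + n.+1 + r.+1)%N; have := f0 (r + lam + n.+1)%N; have := f0 j.
move: (_`!%:R) (_`!%:R) (_`!%:R) (_`!%:R) (_`!%:R) => w1 w2 w3 w4 w5.
move: (_`!%:R) (_`!%:R) ((lam + r).+1%:R) (n.+1%:R) => w6 w7 w8 w9.
by move=> h1 h2 h3; field; rewrite ?h1 ?h2 ?h3.
Qed.

End main.

Theorem theorem6p4 (R : realType) (N : nat) (N_ge1 : (1 <= N)%N)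
    (a : R) (a_gt0 : 0 < a)
    (mu : 'I_N -> R) (mu_gt0 : forall j, 0 < mu j)
    (mu_def : forall j k : 'I_N, (mu j / mu k) ^+ 2 =
       a ^ (k%:Z - j%:Z) * ((N - k.+1)`!)%:R / ((N - j.+1)`!)%:R)
    (delta : nat -> 'I_N -> R)
    (delta_def : forall (lam : nat) (k : 'I_N),
       delta lam k = (a / 2) ^+ lam * ((lam + k)`!)%:R / (k`!)%:R)
    (P : nat -> nat -> 'M[{poly R[i]}]_N)
    (P_mop : forall lam : nat,
       monic_orthogonal (weight a mu delta lam) (P lam))
    (D : nat -> nat -> 'M[R[i]]_N)
    (D_def : forall lam n : nat, is_Dmx a mu delta P lam n (D lam n)) :
  (forall (lam n : nat) (j : 'I_N),
     D lam n j j =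
       ((- 1) ^+ j.+1 * expR a * (n`!)%:R * a ^+ n * (a / 2) ^+ lam
        * (((lam + N - j.+1)`!)%:R / (j`!)%:R)
        * (poch (- N%:R - lam%:R - n%:R) j.+1
           / poch ((lam + n + 1)%:R : R) (N - j.+1 + 1)))%:C) /\
  (forall lam n : nat,
     D lam n = ((n`!)%:R * 2 ^+ n) *:
       (D (lam + n)%N 0%N *m invmx (Lambdamx R N lam n))).
Proof.
have f0 k : k`!%:R != 0 :> R by rewrite pnatr_eq0 -lt0n fact_gt0.
have f0C k : k`!%:R != 0 :> R[i] by rewrite pnatr_eq0 -lt0n fact_gt0.
have DE := D_closedE a_gt0 mu_gt0 mu_def delta_def P_mop D_def.
split=> lam n => [j|].
  rewrite DE; congr (_%:C); have jN := ltn_ord j.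
  have [r NE] : exists r, N = (r + j.+1)%N by exists (N - j.+1)%N; lia.
  have -> : (N - j.+1 = r)%N by lia.
  have -> : (lam + N - j.+1 = lam + r)%N by lia.
  have NR : N%:R = r%:R + j.+1%:R :> R by rewrite -natrD -NE.
  have -> : - N%:R - lam%:R - n%:R = - (r + lam + n + j.+1)%N%:R :> R.
    by rewrite NR !natrD; ring.
  have := poch_neg R (r + lam + n) j.+1; have := poch_pos R (lam + n) (r + 1).
  have -> : (r + lam + n + j.+1 = r + j.+1 + lam + n)%N by lia.
  rewrite [(r + 1)%N]addn1 /D_closed => e1 e2.
  have e1' : poch (lam + n + 1)%:R r.+1 = (lam + n + r.+1)`!%:R / (lam + n)`!%:R :> R.
    by rewrite -e1 mulfK.
  have e2' : poch (- (r + j.+1 + lam + n)%:R) j.+1 =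
     (- 1) ^+ j.+1 * (r + j.+1 + lam + n)`!%:R / (r + lam + n)`!%:R :> R.
    by rewrite -e2 mulfK.
  rewrite e1' e2'; have s1 : (- 1) ^+ j.+1 * (- 1) ^+ j.+1 = 1 :> R.
    by rewrite -exprMn mulN1r opprK expr1n.
  move: s1; rewrite /D_closed; move: ((- 1) ^+ _) => s s1.
  have -> : (r + lam + n)%N = (lam + n + r)%N by lia.
  (* the signs of the formula and of the Pochhammer symbol cancel *)
  rewrite [RHS](_ : _ = s * s * (expR a * n`!%:R * a ^+ n * (a / 2) ^+ lam *
    (lam + n)`!%:R * (r + j.+1 + lam + n)`!%:R * (lam + r)`!%:R /
    (j`!%:R * (lam + n + r)`!%:R * (lam + n + r.+1)`!%:R))); first by rewrite s1 mul1r.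
  have := f0 j; have := f0 (lam + n)%N; have := f0 (lam + n + r)%N.
  have := f0 (lam + n + r.+1)%N.
  move: (_`!%:R) (_`!%:R) (_`!%:R) (_`!%:R) (_`!%:R) => w1 w2 w3 w4 w5.
  move: (_`!%:R) (_`!%:R) ((a / 2) ^+ _) => w6 w7 y.
  by move=> h1 h2 h3 h4; field; rewrite ?h1 ?h2 ?h3 ?h4.
rewrite Lambdamx_diag invmx_diag; last first.
  by move=> i; rewrite mxE mulf_neq0 ?invr_eq0.
apply/matrixP => i j; rewrite mxE (mulDmx D_def) !mxE.
have [<-|ij] := eqVneq i j; last by rewrite (D_diag D_def) // mulr0n !mulr0.
rewrite mulr1n !DE invf_div.
have -> : n`!%:R * 2 ^+ n = (n`!%:R * 2 ^+ n)%:C :> R[i].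
  by rewrite rmorphM rmorphXn !rmorph_nat.
move: (N - i.+1)%N => r.
have -> : (lam + r)`!%:R / (lam + n + r)`!%:R =
    ((lam + r)`!%:R / (lam + n + r)`!%:R)%:C :> R[i].
  by rewrite fmorph_div !rmorph_nat.
rewrite -!rmorphM; congr (_%:C); rewrite /D_closed !addn0 !addnA fact0 expr0 exprD.
rewrite [(a / 2) ^+ n]expr_div_n (_ : (r + lam + n)%N = (lam + n + r)%N); last by lia.
have p2 : 2 ^+ n != 0 :> R by rewrite expf_neq0 // pnatr_eq0.
have := f0 i; have := f0 (lam + n + r)%N; have := f0 (lam + n + r.+1)%N.
move: (2 ^+ n) p2 => w0 h0.
move: (_`!%:R) (_`!%:R) (_`!%:R) (_`!%:R) (_`!%:R) => w1 w2 w3 w4 w5.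
move: (_`!%:R) (_`!%:R) ((a / 2) ^+ _) => w6 w7 y.
by move=> h1 h2 h3; field; rewrite ?h0 ?h1 ?h2 ?h3.
Qed.
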